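(* Let $R$ be a commutative noetherian ring. The equality $\mathsf{ke}(\mathsf{mod}\,R)=\mathsf{torf}(\mathsf{mod}\,R)$ holds if and only if $\operatorname{depth}_{R_{\mathfrak p}}X_{\mathfrak p}\le1$ for every $X\in\mathsf{mod}\,R$ and every $\mathfrak p\in\operatorname{Supp}X$.
   Context: $\mathsf{mod}\,R$ is the category of finitely generated $R$-modules. All subcategories are full and closed under isomorphisms; additive means closed under finite direct sums (so containing $0$). An additive subcategory is KE-closed if it is closed under extensions and under kernels of morphisms between its objects, and a torsion-free class if it is closed under extensions and submodules. $\mathsf{ke}(\mathsf{mod}\,R)$ and $\mathsf{torf}(\mathsf{mod}\,R)$ denote the sets of KE-closed subcategories and of torsion-free classes of $\mathsf{mod}\,R$, respectively. *)

(* Defs.v *)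
From HB Require Import structures.
From mathcomp Require Import all_boot all_order all_algebra generic_quotient.
From mathcomp Require Import ring.
From mathcomp Require Import boolp classical_sets constructive_ereal.

Set Implicit Arguments.
Unset Strict Implicit.
Unset Printing Implicit Defensive.

Import Order.TTheory GRing.Theory Num.Theory.

Local Open Scope classical_set_scope.
Local Open Scope quotient_scope.
Local Open Scope ring_scope.

(* ring_quotient's [idealr] and [prime_idealr] require a nonzero ring and
   proper ideals, hence are not usable here. *)
Definition is_ideal (R : comPzRingType) (I : set R) : Prop :=
  [/\ I 0, forall x y, I x -> I y -> I (x + y) & forall a x, I x -> I (a * x)].

Definition noetherian (R : comPzRingType) : Prop :=
  forall I : set R, is_ideal I ->
  exists (n : nat) (g : 'I_n -> R),
    I = [set x | exists c : 'I_n -> R, x = \sum_(i < n) c i * g i].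

Record prime_ideal (R : comPzRingType) := PrimeIdeal {
  prime_set :> set R;
  prime_setP : [/\ is_ideal prime_set, ~ prime_set 1 &
    forall x y, prime_set (x * y) -> prime_set x \/ prime_set y] }.

Section Localization.
Variables (R : comPzRingType) (p : prime_ideal R).

Record denom := Denom { den : R; denomP : den \notin (p : set R) }.
HB.instance Definition _ := [isSub for den].
HB.instance Definition _ := [Choice of denom by <:].

Lemma denom1_subproof : (1 : R) \notin (p : set R).
Proof. by apply/negP => /set_mem; case: (prime_setP p). Qed.
Definition denom1 : denom := Denom denom1_subproof.

Lemma denomM_subproof (s t : denom) : den s * den t \notin (p : set R).
Proof.
apply/negP => /set_mem; case: (prime_setP p) => _ _ pP /pP.
by case=> /mem_set; apply/negP; exact: denomP.
Qed.
Definition denomM (s t : denom) : denom := Denom (denomM_subproof s t).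

Section Module.
Variable M : lmodType R.

Definition loc_rel (x y : M * denom) : bool :=
  `[< exists u : denom,
        den u *: (den y.2 *: x.1) = den u *: (den x.2 *: y.1) >].

Lemma loc_rel_equiv : equiv_class_of loc_rel.
Proof.
split=> [x|x y|y x z].
- by apply/asboolP; exists denom1.
- by apply/asboolP/asboolP=> -[u e]; exists u.
- move=> /asboolP[u e] /asboolP[v f]; apply/asboolP.
  exists (denomM (denomM u v) y.2); rewrite /= !scalerA.
  rewrite !scalerA in e f.
  have -> : den u * den v * den y.2 * den z.2
      = den v * den z.2 * (den u * den y.2) by ring.
  rewrite -[LHS]scalerA e scalerA [_ * (den u * _)]mulrC -[LHS]scalerA f scalerA; congr (_ *: _).
  by ring.
Qed.

Canonical loc_equiv_rel := EquivRelPack loc_rel_equiv.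

Definition loc_mod : Type := {eq_quot loc_rel}.
HB.instance Definition _ := Choice.on loc_mod.
HB.instance Definition _ : EqQuotient _ loc_rel loc_mod := EqQuotient.on loc_mod.

Definition loc_frac (m : M) (s : denom) : loc_mod := \pi_(loc_mod) (m, s).

Lemma loc_fracP m s n t : loc_frac m s = loc_frac n t <->
  exists u : denom, den u *: (den t *: m) = den u *: (den s *: n).
Proof.
rewrite /loc_frac; split=> [/eqP|h]; first by rewrite piE => /asboolP.
by apply/eqP; rewrite piE; apply/asboolP.
Qed.

Lemma loc_frac_ex (x : loc_mod) : exists m s, x = loc_frac m s.
Proof.
by exists (repr x).1, (repr x).2; rewrite /loc_frac -surjective_pairing reprK.
Qed.

Definition loc_add (x y : loc_mod) : loc_mod :=
  loc_frac (den (repr y).2 *: (repr x).1 + den (repr x).2 *: (repr y).1)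
           (denomM (repr x).2 (repr y).2).
Definition loc_opp (x : loc_mod) : loc_mod := loc_frac (- (repr x).1) (repr x).2.
Definition loc_zero : loc_mod := loc_frac 0 denom1.

Lemma loc_repr m s : exists u : denom,
  den u *: (den s *: (repr (loc_frac m s)).1)
    = den u *: (den (repr (loc_frac m s)).2 *: m).
Proof. by apply/loc_fracP; rewrite /loc_frac -surjective_pairing reprK. Qed.

Lemma loc_fracD m s n t :
  loc_add (loc_frac m s) (loc_frac n t)
    = loc_frac (den t *: m + den s *: n) (denomM s t).
Proof.
rewrite /loc_add; have [u eu] := loc_repr m s; have [v ev] := loc_repr n t.
move: (repr (loc_frac m s)) (repr (loc_frac n t)) eu ev => [m' s'] [n' t'] /= eu ev.
rewrite !scalerA in eu ev.
apply/loc_fracP; exists (denomM u v); rewrite /= !scalerDr !scalerA.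
congr (_ + _).
- have -> : den u * den v * (den s * den t) * den t'
      = den v * den t * den t' * (den u * den s) by ring.
  by rewrite -[LHS]scalerA eu scalerA; congr (_ *: _); ring.
- have -> : den u * den v * (den s * den t) * den s'
      = den u * den s * den s' * (den v * den t) by ring.
  by rewrite -[LHS]scalerA ev scalerA; congr (_ *: _); ring.
Qed.

Lemma loc_fracN m s : loc_opp (loc_frac m s) = loc_frac (- m) s.
Proof.
rewrite /loc_opp; have [u eu] := loc_repr m s.
move: (repr _) eu => [m' s'] /= eu.
by apply/loc_fracP; exists u; rewrite !scalerN eu.
Qed.

Lemma loc_frac_eq m s n t :
  den t *: m = den s *: n -> loc_frac m s = loc_frac n t.
Proof. by move=> e; apply/loc_fracP; exists denom1; rewrite e. Qed.

Lemma loc_addA : associative loc_add.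
Proof.
move=> x y z; have [m [s ->]] := loc_frac_ex x.
have [n [t ->]] := loc_frac_ex y; have [o [w ->]] := loc_frac_ex z.
rewrite !loc_fracD; apply: loc_frac_eq; rewrite /= !scalerDr !scalerA.
by rewrite addrA; congr (_ *: _ + _ *: _ + _ *: _); ring.
Qed.

Lemma loc_addC : commutative loc_add.
Proof.
move=> x y; have [m [s ->]] := loc_frac_ex x; have [n [t ->]] := loc_frac_ex y.
rewrite !loc_fracD; apply: loc_frac_eq; rewrite /= !scalerDr !scalerA addrC.
by congr (_ *: _ + _ *: _); ring.
Qed.

Lemma loc_add0 : left_id loc_zero loc_add.
Proof.
move=> x; have [m [s ->]] := loc_frac_ex x.
rewrite loc_fracD; apply: loc_frac_eq; rewrite /= scaler0 add0r !scalerA.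
by congr (_ *: _); ring.
Qed.

Lemma loc_addN : left_inverse loc_zero loc_opp loc_add.
Proof.
move=> x; have [m [s ->]] := loc_frac_ex x.
rewrite loc_fracN loc_fracD; apply: loc_frac_eq.
by rewrite /= scalerN addNr !scaler0.
Qed.

HB.instance Definition _ :=
  GRing.isZmodule.Build loc_mod loc_addA loc_addC loc_add0 loc_addN.

Lemma loc_frac_add m s n t : loc_frac m s + loc_frac n t
  = loc_frac (den t *: m + den s *: n) (denomM s t).
Proof. exact: loc_fracD. Qed.

End Module.

Definition loc_ring : Type := loc_mod R^o.
HB.instance Definition _ := GRing.Zmodule.on loc_ring.

Definition loc_ofrac (a : R) (s : denom) : loc_ring := loc_frac (a : R^o) s.

Lemma loc_ofrac_add (a b : R) s t : loc_ofrac a s + loc_ofrac b t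
  = loc_ofrac (den t * a + den s * b) (denomM s t).
Proof. exact: (@loc_fracD R^o). Qed.

Definition loc_scale (M : lmodType R) (a : loc_ring) (x : loc_mod M) : loc_mod M :=
  loc_frac (((repr a).1 : R) *: (repr x).1) (denomM (repr a).2 (repr x).2).

Lemma loc_ring_ex (a : loc_ring) : exists r s, a = loc_ofrac r s.
Proof. exact: (@loc_frac_ex R^o a). Qed.

Lemma loc_fracZ (M : lmodType R) (a : R) s (m : M) t :
  loc_scale (loc_ofrac a s) (loc_frac m t) = loc_frac (a *: m) (denomM s t).
Proof.
rewrite /loc_scale; have [u eu] := loc_repr (a : R^o) s.
have [v ev] := loc_repr m t; rewrite /loc_ofrac.
move: (repr (loc_frac (a : R^o) s)) (repr (loc_frac m t)) eu ev => [a' s'] [m' t'] /= eu ev.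
rewrite scalerA in ev; rewrite !scalerA in ev.
have {}eu : den u * den s * a' = den u * den s' * a by rewrite -!mulrA; exact: eu.
apply/loc_fracP; exists (denomM u v); rewrite /= !scalerA.
have -> : den u * den v * (den s * den t) * a'
  = den u * den s * a' * (den v * den t) by ring.
by rewrite eu -[LHS]scalerA ev scalerA; congr (_ *: _); ring.
Qed.

Section Scale.
Variable M : lmodType R.
Implicit Types (a b : loc_ring) (x y : loc_mod M).

Lemma loc_scaleA a b x :
  loc_scale a (loc_scale b x) = loc_scale (loc_scale (M := R^o) a b) x.
Proof.
have [r [s ->]] := loc_ring_ex a; have [r' [s' ->]] := loc_ring_ex b.
have [m [t ->]] := loc_frac_ex x.
rewrite loc_fracZ loc_fracZ (loc_fracZ (M := R^o)) loc_fracZ.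
by apply: loc_frac_eq; rewrite /= !scalerA; congr (_ *: _);
rewrite /GRing.scale /=; ring.
Qed.

Lemma loc_scale1 x : loc_scale (loc_ofrac 1 denom1) x = x.
Proof.
have [m [t ->]] := loc_frac_ex x; rewrite loc_fracZ; apply: loc_frac_eq.
by rewrite /= scale1r mul1r.
Qed.

Lemma loc_scaleDr a x y :
  loc_scale a (x + y) = loc_scale a x + loc_scale a y.
Proof.
have [r [s ->]] := loc_ring_ex a; have [m [t ->]] := loc_frac_ex x.
have [n [w ->]] := loc_frac_ex y.
rewrite loc_frac_add !loc_fracZ loc_frac_add.
apply: loc_frac_eq; rewrite /= !scalerDr !scalerA.
by congr (_ *: _ + _ *: _); ring.
Qed.

Lemma loc_scaleDl a b x :
  loc_scale (a + b) x = loc_scale a x + loc_scale b x.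
Proof.
have [r [s ->]] := loc_ring_ex a; have [r' [s' ->]] := loc_ring_ex b.
have [m [t ->]] := loc_frac_ex x.
rewrite loc_ofrac_add !loc_fracZ loc_frac_add.
apply: loc_frac_eq; rewrite /= !scalerA -scalerDl !scalerA.
by congr (_ *: _); rewrite /GRing.scale /=; ring.
Qed.

End Scale.

Definition loc_mul : loc_ring -> loc_ring -> loc_ring := @loc_scale R^o.

Lemma loc_mulA : associative loc_mul.
Proof. exact: loc_scaleA. Qed.

Lemma loc_mulC : commutative loc_mul.
Proof.
move=> a b; have [r [s ->]] := loc_ring_ex a; have [r' [s' ->]] := loc_ring_ex b.
rewrite /loc_mul !(loc_fracZ (M := R^o)); apply: loc_frac_eq.
by rewrite /GRing.scale /=; ring.
Qed.

Lemma loc_mulDl : left_distributive loc_mul +%R.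
Proof. by move=> a b c; exact: loc_scaleDl. Qed.

HB.instance Definition _ := GRing.Zmodule_isComPzRing.Build loc_ring
  loc_mulA loc_mulC (@loc_scale1 R^o) loc_mulDl.

Section LmodInstance.
Variable M : lmodType R.

Lemma loc_scaleDl' (x : loc_mod M) : {morph (@loc_scale M)^~ x : a b / a + b}.
Proof. by move=> a b; exact: loc_scaleDl. Qed.

HB.instance Definition _ := GRing.Zmodule_isLmodule.Build loc_ring (loc_mod M)
  (@loc_scaleA M) (@loc_scale1 M) (@loc_scaleDr M) loc_scaleDl'.
End LmodInstance.

(* Hence the non-units of R_p form the ideal pR_p: R_p is local. *)
Lemma loc_ofrac_unitP (r : R) (s : denom) :
  (exists b : loc_ring, b * loc_ofrac r s = 1) <-> ~ prime_set p r.
Proof.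
have [[_ _ pM] _ _] := prime_setP p.
have denP (u : denom) : ~ prime_set p (den u).
  by move=> /mem_set pu; have := denomP u; rewrite pu.
split=> [[b]|pr].
- have [r' [s' ->]] := loc_ring_ex b.
  move=> /(_ =P _) /eqP e pr.
  have {e} : loc_scale (M := R^o) (loc_ofrac r' s') (loc_ofrac r s)
    = loc_ofrac 1 denom1 by [].
  rewrite (@loc_fracZ R^o) => /loc_fracP[u] /= e.
  apply: (denP (denomM u (denomM s' s))) => /=.
  rewrite -[X in _ * X]mulr1 -[_ * (_ * 1)]e.
  have -> : den u *: (1 *: (r' *: (r : R^o))) = (den u * r') * r :> R.
    by rewrite scale1r /GRing.scale /= mulrA.
  exact: pM.
- have npr : r \notin prime_set p by apply/negP => /set_mem.
  exists (loc_ofrac (den s) (Denom npr)).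
  apply: etrans (_ : _ = loc_ofrac 1 denom1) _ => //.
  apply: etrans (@loc_fracZ R^o _ _ _ _) _; apply: loc_frac_eq => /=.
  by rewrite /GRing.scale /=; ring.
Qed.

End Localization.

Definition fin_gen (R : comPzRingType) (M : lmodType R) : Prop :=
  exists (n : nat) (g : 'I_n -> M),
    forall x : M, exists c : 'I_n -> R, x = \sum_(i < n) c i *: g i.

(* the objects of mod R *)
Record fgmod (R : comPzRingType) := FgMod {
  fgmod_sort :> lmodType R;
  fgmodP : fin_gen fgmod_sort }.

(* A full subcategory is given by its objects. [set (fgmod R)] would be a
   universe inconsistency. *)
Definition subcat (R : comPzRingType) := fgmod R -> Prop.

Section Subcategories.
Variable R : comPzRingType.
Implicit Types (C : subcat R) (X Y Z K : fgmod R).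

Definition iso_closed C : Prop :=
  forall X Y (f : {linear X -> Y}), bijective f -> C X -> C Y.

Definition additive_subcat C : Prop :=
  [/\ iso_closed C,
      forall X, (forall x : X, x = 0) -> C X &
      forall X Y Z (f : {linear (X * Y)%type -> Z}),
        bijective f -> C X -> C Y -> C Z].

Definition ext_closed C : Prop :=
  forall X Y Z (f : {linear X -> Y}) (g : {linear Y -> Z}),
    injective f -> range f = [set y | g y = 0] -> range g = setT ->
    C X -> C Z -> C Y.

Definition ker_closed C : Prop :=
  forall X Y K (f : {linear X -> Y}) (k : {linear K -> X}),
    injective k -> range k = [set x | f x = 0] ->
    C X -> C Y -> C K.

Definition sub_closed C : Prop :=
  forall X Y (f : {linear X -> Y}), injective f -> C Y -> C X.

Definition ke : subcat R -> Prop := fun C =>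
  [/\ additive_subcat C, ext_closed C & ker_closed C].

Definition torf : subcat R -> Prop := fun C =>
  [/\ additive_subcat C, ext_closed C & sub_closed C].

End Subcategories.

Arguments ke R C : clear implicits.
Arguments torf R C : clear implicits.

Definition supp (R : comPzRingType) (M : lmodType R) : set (prime_ideal R) :=
  [set p | exists x : loc_mod p M, x != 0].

Section Depth.
Variables (A : comPzRingType) (M : lmodType A).

(* the submodule (a_0, ..., a_(n-1))M *)
Definition seq_mul (a : seq A) : set M :=
  [set m | exists f : 'I_(size a) -> M, m = \sum_(i < size a) a`_i *: f i].

Definition regular_seq (a : seq A) : Prop :=
  (forall i, (i < size a)%N -> forall m : M,
     seq_mul (take i a) (a`_i *: m) -> seq_mul (take i a) m)
  /\ seq_mul a <> setT.

(* For A local, the maximal ideal is the set of non-units. *)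
Definition nonunits : set A := [set x | ~ exists y, y * x = 1].

(* Supremum of the lengths of the M-regular sequences in the maximal ideal of
   the local ring A, with the convention that the zero module, for which no
   sequence is regular, has infinite depth. *)
Definition depth : \bar int :=
  supremum +oo%E [set n%:Z%:E | n in [set n | exists a : seq A,
    [/\ size a = n, {subset a <= nonunits} & regular_seq a]]].

End Depth.

(* Main.v *)
From HB Require Import structures.
Require Import Defs.
From mathcomp Require Import all_boot all_order all_algebra.
From mathcomp Require Import ring.
From mathcomp Require Import boolp classical_sets constructive_ereal.

Set Implicit Arguments.
Unset Strict Implicit.
Unset Printing Implicit Defensive.

Import Order.TTheory GRing.Theory Num.Theory.

Local Open Scope classical_set_scope.
Local Open Scope ring_scope.

(** The proof works with the vanishing of the Koszul cohomology in degrees 0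
    and 1 instead of [Ext], and with submodules of finitely generated modules
    instead of quotients.

    Only if. Suppose that [a], [b] in [p] form a regular sequence on [X] at [p].
    The modules [Y] such that, at [p], every pair [(y, z)] with [a z = b y] is
    [(a w, b w)] for a unique [w] are those whose Koszul cohomology on [a], [b]
    vanishes in degrees 0 and 1, and they form a KE-closed subcategory
    ([depth_ge2_ke]). It contains [X], but not the submodule [a X + b X], where
    the pair [(a x, b x)] comes from [x] only; so it is not a torsion-free class
    ([ke_torf_no_regular]).

    If. Let [C] be KE-closed. Filtering by cyclic quotients [R/p], one sees that
    [C] is closed under submodules as soon as it contains the kernel [M] of any
    surjection [X -> R/p] with [X] in [C] ([inC_descend]). This holds if [R/p]
    embeds into a quotient [W/Y] with [Y] and [W] in [C]: the fibre product of
    [X] and of the preimage of [R/p] in [W] is an extension of [X] by [Y], hence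
    lies in [C], and [M] is the kernel of its map to [W] ([cyc_ker_of_class]).

    To find [W] and [Y], one argues by noetherian induction on [p], the larger
    primes first. If [X] has depth 0 at [p], then [R/p] embeds into [X]. If
    not, [X] is first replaced by its quotient by the elements supported
    strictly above [p]; this quotient embeds into the module of Koszul
    1-cocycles of an ideal, which is in [C], with a cokernel supported strictly
    above [p], so it is in [C] by induction ([cyc_ker_step]). Then [p] kills no
    nonzero element of [X], so [X] embeds into the 1-cocycles of generators of
    [p], the cokernel is killed by [p], and it is nonzero at [p] since [X] has
    depth 1 there ([noncoboundary_ex]); thus it contains [R/p].

    The last point rests on the fact that a prime killing no nonzero element of
    a finitely generated module contains a regular element ([regular_elt], by
    prime avoidance), and on Nakayama's lemma ([nakayama]). *)

(** * Submodules and noetherian induction *)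

Section Submodules.
Variables (R : comPzRingType) (M : lmodType R).
Implicit Types (N : set M) (x y z : M) (r : R).

Definition is_submod N : Prop :=
  [/\ N 0, forall x y, N x -> N y -> N (x + y) & forall a x, N x -> N (a *: x)].

Lemma submodB N x y : is_submod N -> N x -> N y -> N (x - y).
Proof.
by case=> _ ND NZ Nx Ny; apply: ND => //; rewrite -scaleN1r; apply: NZ.
Qed.

Lemma submod_subK N x y : is_submod N -> N y -> N (x - y) -> N x.
Proof. by case=> _ ND _ Ny Nxy; rewrite -[x](subrK y); apply: ND. Qed.

Lemma submod_sum N (I : finType) (F : I -> M) :
  is_submod N -> (forall i, N (F i)) -> N (\sum_i F i).
Proof. by case=> N0 ND _ NF; elim/big_ind: _. Qed.

Lemma is_submod0 : is_submod [set 0].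
Proof.
by split=> [//|x y -> ->|a x ->] /=; [rewrite addr0 | rewrite scaler0].
Qed.

Lemma is_submodT : is_submod setT.
Proof. by split. Qed.

Lemma is_submodI N N' : is_submod N -> is_submod N' -> is_submod (N `&` N').
Proof.
move=> [N0 ND NZ] [N'0 N'D N'Z]; split=> [//|x y [? ?] [? ?]|a x [? ?]].
  by split; [apply: ND|apply: N'D].
by split; [apply: NZ|apply: N'Z].
Qed.

Definition add_line N x : set M := [set y | exists r, N (y - r *: x)].

Lemma is_submod_add_line N x : is_submod N -> is_submod (add_line N x).
Proof.
move=> [N0 ND NZ]; split=> [|y z [r Nr] [s Ns]|a y [r Nr]].
- by exists 0; rewrite scale0r subr0.
- by exists (r + s); rewrite scalerDl opprD addrACA; apply: ND.
- by exists (a * r); rewrite -scalerA -scalerBr; apply: NZ.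
Qed.

Lemma sub_add_line N x : N `<=` add_line N x.
Proof. by move=> y Ny; exists 0; rewrite scale0r subr0. Qed.

Lemma mem_add_line N x : is_submod N -> add_line N x x.
Proof. by case=> N0 _ _; exists 1; rewrite scale1r subrr. Qed.

Lemma add_line_proper N x : is_submod N -> ~ N x -> N `<` add_line N x.
Proof.
move=> hN Nx; split; first exact: sub_add_line.
by move=> /(_ x (mem_add_line x hN)).
Qed.

Lemma add_line_sub N N' x :
  is_submod N' -> N `<=` N' -> N' x -> add_line N x `<=` N'.
Proof.
move=> hN' NN' N'x y [r Nr]; apply: (submod_subK hN' _ (NN' _ Nr)).
by case: hN' => _ _; apply.
Qed.

Definition gen (A : set M) : set M :=
  [set x | forall N, is_submod N -> A `<=` N -> N x].

Lemma is_submod_gen A : is_submod (gen A).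
Proof.
split=> [N [] //|x y gx gy N hN AN|a x gx N hN AN]; case: (hN) => _ ND NZ.
  by apply: ND; [apply: gx|apply: gy].
by apply: NZ; apply: gx.
Qed.

Lemma sub_gen A : A `<=` gen A.
Proof. by move=> x Ax N _; apply. Qed.

Lemma gen_min A N : is_submod N -> A `<=` N -> gen A `<=` N.
Proof. by move=> hN AN x; apply. Qed.

Definition noeth_mod : Prop :=
  forall N, is_submod N -> exists s : seq M, N = gen [set` s].

(** The family of the submodules violating [P] would contain a strictly
    increasing sequence, but its union is generated by finitely many elements,
    which already lie in one of its terms. *)
Lemma noeth_ind (P : set M -> Prop) : noeth_mod ->
  (forall N, is_submod N ->
     (forall N', is_submod N' -> N `<` N' -> P N') -> P N) ->
  forall N, is_submod N -> P N.
Proof.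
move=> noethM step N0 hN0; apply: contrapT => PN0.
pose bad N := is_submod N /\ ~ P N.
have next (N : {N | bad N}) : exists N' : {N | bad N}, sval N `<` sval N'.
  case: N => N [hN PN] /=; apply: contrapT => noN'; apply: PN.
  apply: step => // N' hN' NN'; apply: contrapT => PN'.
  by apply: noN'; exists (exist _ N' (conj hN' PN')).
have [h hP] := choice next.
pose F k := iter k h (exist _ N0 (conj hN0 PN0)); pose f k := sval (F k).
have hf k : is_submod (f k) by case: (svalP (F k)).
have fS k : f k `<` f k.+1 by exact: hP.
have f_mono i j : (i <= j)%N -> f i `<=` f j.
  elim: j => [|j IH]; first by rewrite leqn0 => /eqP ->.
  rewrite leq_eqVlt => /predU1P[-> //|/IH fij].
  by apply: (subset_trans fij); case: (fS j).
pose U := [set x | exists k, f k x].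
have hU : is_submod U.
  split=> [|x y [i fi] [j fj]|a x [i fi]].
  - by exists 0; case: (hf 0).
  - exists (maxn i j); have [_ fD _] := hf (maxn i j).
    by apply: fD; [apply: (f_mono i) fi|apply: (f_mono j) fj];
      rewrite ?leq_maxl ?leq_maxr.
  - by exists i; have [_ _ fZ] := hf i; apply: fZ.
have [s Us] := noethM U hU.
have [k sk] : exists k, [set` s] `<=` f k.
  have : [set` s] `<=` U by rewrite Us; exact: sub_gen.
  elim: s {Us} => [|g s IH] sU; first by exists 0.
  have [k1 gk1] : U g by apply: sU; rewrite /= mem_head.
  have [|k2 sk2] := IH.
    by move=> x /= xs; apply: sU; rewrite /= inE xs orbT.
  exists (maxn k1 k2) => x /=; rewrite inE => /predU1P[->|xs].
    by apply: (f_mono k1) gk1; exact: leq_maxl.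
  by apply: (f_mono k2); [exact: leq_maxr|exact: sk2].
have [_] := fS k; apply; apply: subset_trans (gen_min (hf k) sk).
by rewrite -Us => x fx; exists k.+1.
Qed.

Lemma noeth_max (P : set M -> Prop) : noeth_mod ->
  (exists2 N, is_submod N & P N) ->
  exists N, [/\ is_submod N, P N &
    forall N', is_submod N' -> N `<=` N' -> P N' -> N' `<=` N].
Proof.
move=> noethM [N0 hN0 PN0]; apply: contrapT => noN; move: PN0.
refine (@noeth_ind (fun N => ~ P N) noethM _ _ hN0) => N hN IH PN.
apply: noN; exists N; split=> // N' hN' NN' PN'.
by apply: contrapT => N'N; apply: (IH N').
Qed.

End Submodules.

Arguments gen {R M} A.

(** Closure of a subcategory is about bundled maps, whereas the maps below are
    explicit formulas with a proof of [linear f]. *)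
Lemma linear_bundle (R : comPzRingType) (X Y : lmodType R) (f : X -> Y) :
  linear f -> exists g : {linear X -> Y}, g =1 f.
Proof.
move=> lf.
pose F := GRing.isLinear.Build R X Y *:%R f lf.
pose g : {linear X -> Y} := HB.pack f F.
by exists g.
Qed.

Section LinearImages.
Variables (R : comPzRingType) (X Y : lmodType R) (f : X -> Y).
Hypothesis lf : linear f.

Lemma lin0 : f 0 = 0.
Proof. by have [g gf] := linear_bundle lf; rewrite -gf linear0. Qed.
Lemma linD x y : f (x + y) = f x + f y.
Proof. by have [g gf] := linear_bundle lf; rewrite -!gf linearD. Qed.
Lemma linZ a x : f (a *: x) = a *: f x.
Proof. by have [g gf] := linear_bundle lf; rewrite -!gf linearZ. Qed.

Lemma is_submod_image N : is_submod N -> is_submod (f @` N).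
Proof.
move=> [N0 ND NZ]; split=> [|_ _ [x Nx <-] [y Ny <-]|a _ [x Nx <-]].
- by exists 0 => //; exact: lin0.
- by exists (x + y); [exact: ND|exact: linD].
- by exists (a *: x); [exact: NZ|exact: linZ].
Qed.

Lemma is_submod_preimage N : is_submod N -> is_submod (f @^-1` N).
Proof.
move=> [N0 ND NZ]; split=> [|x y|a x] /=; rewrite ?lin0 ?linD ?linZ //.
  exact: ND.
exact: NZ.
Qed.

Lemma is_submod_ker : is_submod [set x | f x = 0].
Proof. exact: (is_submod_preimage (is_submod0 Y)). Qed.

End LinearImages.

(** * Finite generation *)

Section FiniteGeneration.
Variable R : comPzRingType.
Implicit Types M : lmodType R.

Lemma fin_genP M : fin_gen M <-> exists s : seq M, gen [set` s] = setT.
Proof.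
split=> [[n [g gP]]|[s sP]].
  exists (codom g); apply/seteqP; split=> // x _ N hN sN.
  have [c ->] := gP x; apply: submod_sum => // i; case: (hN) => _ _; apply.
  by apply: sN; rewrite /= codom_f.
exists (size s), (fun i => s`_i) => x.
suff: gen [set` s] `<=`
    [set x | exists c : 'I_(size s) -> R, x = \sum_(i < size s) c i *: s`_i].
  by apply; rewrite sP.
apply: gen_min => [|g /= gs].
  split=> [|_ _ [c ->] [d ->]|a _ [c ->]].
  - by exists (fun=> 0); rewrite big1 // => i _; rewrite scale0r.
  - exists (fun i => c i + d i); rewrite -big_split; apply: eq_bigr => i _.
    by rewrite scalerDl.
  - exists (fun i => a * c i); rewrite scaler_sumr; apply: eq_bigr => i _.
    by rewrite scalerA.
have gi : (index g s < size s)%N by rewrite index_mem.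
exists (fun i => (i == Ordinal gi)%:R); rewrite (bigD1 (Ordinal gi)) //=.
rewrite eqxx scale1r nth_index // big1 ?addr0 // => i /negbTE ->.
by rewrite scale0r.
Qed.

Lemma noetherian_ideal : noetherian R -> noeth_mod R^o.
Proof.
move=> hR I hI.
have [n [g Ig]] : exists (n : nat) (g : 'I_n -> R), I =
    [set x | exists c : 'I_n -> R, x = \sum_(i < n) c i * g i] by exact: hR.
exists (codom (g : 'I_n -> R^o)); apply/seteqP; split=> [x|].
  rewrite {1}Ig => -[c ->] N hN sN; apply: (@submod_sum R R^o) => // i.
  case: (hN) => _ _ NZ; apply: (NZ (c i) (g i)); apply: sN.
  by rewrite /= codom_f.
apply: gen_min => // _ /= /codomP[i ->]; rewrite Ig.
exists (fun j => (j == i)%:R); rewrite (bigD1 i) //= eqxx mul1r.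
by rewrite big1 ?addr0 // => j /negbTE ->; rewrite mul0r.
Qed.

(** Induction on a generating sequence [g :: s]: the coefficients along [g] of
    the elements of [N] form an ideal, so modulo the span of [s] the submodule
    [N] is generated by lifts of finitely many ideal generators. *)
Lemma fin_gen_noeth M : noetherian R -> fin_gen M -> noeth_mod M.
Proof.
move=> hR /fin_genP[s sT] N hN.
have : N `<=` gen [set` s] by rewrite sT.
elim: s {sT} N hN => [|g s IH] N hN Ns.
  exists [::]; apply/seteqP; split=> // x.
  by apply: gen_min => // y /=; rewrite in_nil.
pose S := gen [set` s]; have hS : is_submod S by exact: is_submod_gen.
pose J : set R^o := [set r | exists2 x, N x & S (x - r *: g)].
have hJ : is_submod J.
  case: (hN) (hS) => N0 ND NZ [S0 SD SZ].
  split=> [|a b [x Nx Sx] [y Ny Sy]|a b [x Nx Sx]].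
  - by exists 0; rewrite // scale0r subr0.
  - exists (x + y); first exact: ND.
    by rewrite scalerDl opprD addrACA; apply: SD.
  - exists (a *: x); first exact: NZ.
    by rewrite -scalerA -scalerBr; apply: SZ.
have [l Jl] := noetherian_ideal hR hJ.
have lift r : exists x, J r -> N x /\ S (x - r *: g).
  have [[x Nx Sx]|nJ] := pselect (J r); first by exists x.
  by exists 0.
have [h hP] := choice lift.
have [|t Nt] := IH (N `&` S) (is_submodI hN hS); first by move=> x [].
have lJ : [set` l] `<=` J by rewrite Jl; exact: sub_gen.
have tN : [set` t] `<=` N `&` S by rewrite Nt; exact: sub_gen.
exists (map h l ++ t); apply/seteqP; split; last first.
  apply: gen_min => // x /=; rewrite mem_cat => /orP[/mapP[r rl ->]|xt].
    by have [] := hP r (lJ r rl).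
  by have [] := tN x xt.
move=> x Nx; set T := gen _; have hT : is_submod T by exact: is_submod_gen.
have [r Sr] : add_line S g x.
  apply: Ns Nx _ (is_submod_add_line g hS) _ => y /=.
  rewrite inE => /predU1P[->|ys]; first exact: mem_add_line.
  by apply: sub_add_line; exact: sub_gen.
have [y Ty Sy] : exists2 y, (T `&` N) y & S (y - r *: g).
  have Jr : J r by exists x.
  have hTN := is_submodI hT hN.
  have : gen [set` l] `<=` [set r | exists2 y, (T `&` N) y & S (y - r *: g)].
    case: (hTN) (hS) => TN0 TND TNZ [S0 SD SZ].
    apply: gen_min => [|a /= al].
      split=> [|a b [y Ty Sy] [z Tz Sz]|a b [y Ty Sy]].
      - by exists 0; rewrite // scale0r subr0.
      - exists (y + z); first exact: TND.
        by rewrite scalerDl opprD addrACA; apply: SD.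
      - exists (a *: y); first exact: TNZ.
        by rewrite -scalerA -scalerBr; apply: SZ.
    have [Na Sa] := hP a (lJ a al); exists (h a) => //; split=> //.
    by apply: sub_gen; rewrite /= mem_cat map_f.
  by rewrite -Jl; apply.
have [Ty' Ny] := Ty.
apply: (submod_subK hT Ty').
have : (N `&` S) (x - y).
  split; first exact: submodB.
  have -> : x - y = (x - r *: g) - (y - r *: g).
    by rewrite opprB addrA subrK.
  exact: (submodB hS).
rewrite Nt => /(_ T hT); apply => z /= zt.
by apply: sub_gen; rewrite /= mem_cat zt orbT.
Qed.

End FiniteGeneration.

(** * Submodules as objects *)

Section SubModuleType.
Variables (R : comPzRingType) (M : lmodType R) (N : set M).

Definition subm (hN : is_submod N) : Type := {x : M | x \in N}.

Variable hN : is_submod N.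

HB.instance Definition _ := SubChoice.on (subm hN).

Lemma subm_closed : subsemimod_closed (mem N).
Proof.
case: hN => N0 ND NZ; split; first split.
- exact: mem_set.
- by move=> x y /set_mem Nx /set_mem Ny; apply: mem_set; apply: ND.
- by move=> a x /set_mem Nx; apply: mem_set; apply: NZ.
Qed.

HB.instance Definition _ :=
  GRing.SubChoice_isSubLmodule.Build R M (mem N) (subm hN) subm_closed.

Definition emb (u : subm hN) : M := \val u.

Lemma emb_inj : injective emb.
Proof. exact: val_inj. Qed.

Lemma emb_lin : linear emb.
Proof. by move=> a u v; rewrite /emb linearP. Qed.

Lemma emb0 : emb 0 = 0.
Proof. exact: lin0 emb_lin. Qed.

Lemma emb_in (u : subm hN) : N (emb u).
Proof. exact: set_mem (valP u). Qed.

Lemma emb_onto x : N x -> exists u : subm hN, emb u = x.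
Proof. by move=> /mem_set Nx; exists (Sub x Nx); rewrite /emb SubK. Qed.

Lemma subm_fin_gen : noeth_mod M -> fin_gen (subm hN).
Proof.
move=> noethM; have [s Ns] := noethM _ hN.
apply/fin_genP; exists (pmap insub s); apply/seteqP; split=> // u _ L hL sL.
have : N `<=` emb @` L.
  rewrite {1}Ns; apply: gen_min; first exact: is_submod_image emb_lin _ hL.
  move=> x /= xs; have [|v vx] := @emb_onto x.
    by rewrite Ns; exact: sub_gen.
  by exists v => //; apply: sL; rewrite /= mem_pmap_sub [\val v]vx.
by move=> /(_ _ (emb_in u))[v Lv /emb_inj <-].
Qed.

End SubModuleType.

Lemma subm_lift (R : comPzRingType) (X Y : lmodType R) (A : set X) (B : set Y)
    (hA : is_submod A) (hB : is_submod B) (f : X -> Y) :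
  linear f -> (forall x, A x -> B (f x)) ->
  exists g : {linear subm hA -> subm hB}, forall u, emb (g u) = f (emb u).
Proof.
move=> lf fAB.
have lift (u : subm hA) : exists v : subm hB, emb v = f (emb u).
  by apply: emb_onto; apply: fAB; exact: emb_in.
have [g gE] := choice lift.
have [|h hg] := @linear_bundle _ _ _ g; last by exists h => u; rewrite hg gE.
by move=> a u v; apply: emb_inj; rewrite gE !emb_lin lf !gE.
Qed.

Lemma linear_injP (R : comPzRingType) (X Y : lmodType R) (f : {linear X -> Y}) :
  (forall x, f x = 0 -> x = 0) -> injective f.
Proof.
move=> f0 x y fxy; apply/eqP; rewrite -subr_eq0; apply/eqP; apply: f0.
by rewrite linearB fxy subrr.
Qed.

Lemma bij_onto (T U : Type) (f : T -> U) :
  injective f -> (forall y, exists x, f x = y) -> bijective f.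
Proof.
move=> fI /choice[g gK]; exists g => // x; exact/fI/gK.
Qed.

Lemma fin_gen_prod (R : comPzRingType) (X Y : lmodType R) :
  fin_gen X -> fin_gen Y -> fin_gen (X * Y)%type.
Proof.
move=> /fin_genP[s sT] /fin_genP[t tT]; apply/fin_genP.
exists ([seq (x, 0) | x <- s] ++ [seq (0, y) | y <- t]).
apply/seteqP; split=> // -[x y] _ N hN stN; have [_ ND _] := hN.
have -> : (x, y) = (x, 0) + (0, y) by congr (_, _); rewrite ?addr0 ?add0r.
apply: ND.
  pose f (x : X) : (X * Y)%type := (x, 0).
  have lf : linear f by move=> a u v; congr (_, _); rewrite /= scaler0 addr0.
  have : gen [set` s] `<=` f @^-1` N.
    apply: gen_min; first exact: is_submod_preimage.
    by move=> u us; apply: stN; rewrite /= mem_cat map_f.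
  by apply; rewrite sT.
pose f (y : Y) : (X * Y)%type := (0, y).
have lf : linear f by move=> a u v; congr (_, _); rewrite /= scaler0 addr0.
have : gen [set` t] `<=` f @^-1` N.
  apply: gen_min; first exact: is_submod_preimage.
  by move=> u us; apply: stN; rewrite /= mem_cat map_f ?orbT.
by apply; rewrite tT.
Qed.

Lemma fin_gen_ffun (R : comPzRingType) (I : finType) (X : lmodType R) :
  fin_gen X -> fin_gen {ffun I -> X}.
Proof.
move=> /fin_genP[s sT]; apply/fin_genP.
pose f (i : I) (x : X) : {ffun I -> X} := [ffun j => if j == i then x else 0].
exists [seq f i x | i <- enum I, x <- s].
apply/seteqP; split=> // x _ N hN sN.
have -> : x = \sum_i f i (x i).
  apply/ffunP => j; rewrite sum_ffunE (bigD1 j) //= ffunE eqxx.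
  by rewrite big1 ?addr0 // => i ij; rewrite ffunE eq_sym (negbTE ij).
apply: submod_sum => // i.
have lf : linear (f i).
  move=> a u v; apply/ffunP => j; rewrite !ffunE.
  by case: ifP => // _; rewrite scaler0 addr0.
have : gen [set` s] `<=` f i @^-1` N.
  apply: gen_min; first exact: is_submod_preimage.
  by move=> u us; apply: sN; apply/allpairsP; exists (i, u); rewrite mem_enum.
by apply; rewrite sT.
Qed.

Definition prod_fg (R : comPzRingType) (X Y : fgmod R) : fgmod R :=
  FgMod (fin_gen_prod (fgmodP X) (fgmodP Y)).

Definition ffun_fg (R : comPzRingType) (I : finType) (X : fgmod R) : fgmod R :=
  FgMod (fin_gen_ffun I (fgmodP X)).

(** * Submodules that belong to a KE-closed subcategory *)

Section InSubcat.
Variables (R : comPzRingType) (hR : noetherian R).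
Implicit Types X Y Z : fgmod R.

Lemma fgmod_noeth X : noeth_mod X.
Proof. exact: fin_gen_noeth (fgmodP X). Qed.

Definition subfg X (A : set X) (hA : is_submod A) : fgmod R :=
  FgMod (subm_fin_gen hA (@fgmod_noeth X)).

Variables (C : subcat R) (hC : ke R C).

Definition inC X (A : set X) : Prop :=
  exists hA : is_submod A, C (subfg hA).

Lemma inC_submod X (A : set X) : inC A -> is_submod A.
Proof. by case. Qed.

Lemma ke_iso X Y (f : {linear X -> Y}) :
  injective f -> (forall y, exists x, f x = y) -> C X -> C Y.
Proof.
move=> fI fS; have [[iso _ _] _ _] := hC; exact: iso (bij_onto fI fS).
Qed.

Lemma inC0 X : inC [set 0 : X].
Proof.
exists (is_submod0 X); have [[_ C0 _] _ _] := hC; apply: C0 => u.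
by apply: emb_inj; have := emb_in u => /= ->.
Qed.

Lemma inCT X : C X -> inC [set: X].
Proof.
move=> CX; exists (is_submodT X).
have lift (x : X) : exists u : subm (is_submodT X), emb u = x.
  exact: emb_onto.
have [g gE] := choice lift.
have lg : linear g by move=> a u v; apply: emb_inj; rewrite emb_lin !gE.
have [f fg] := linear_bundle lg.
apply: (@ke_iso X (subfg (is_submodT X)) f) => // [x y|u].
  by rewrite !fg => /(congr1 (@emb _ _ _ _)); rewrite !gE.
by exists (emb u); rewrite fg; apply: emb_inj; rewrite gE.
Qed.

Lemma inC_image X Y (A : set X) (f : X -> Y) :
  linear f -> (forall x, A x -> f x = 0 -> x = 0) -> inC A -> inC (f @` A).
Proof.
move=> lf f0 [hA CA]; exists (is_submod_image lf hA).
have [|g gE] := subm_lift hA (is_submod_image lf hA) lf.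
  by move=> x Ax; exists x.
apply: (@ke_iso (subfg hA) (subfg (is_submod_image lf hA)) g) CA.
  apply: linear_injP => u gu0; apply: emb_inj; rewrite emb0.
  by apply: f0 (emb_in u) _; rewrite -gE gu0 emb0.
move=> v; have [x Ax xv] := emb_in v; have [u ux] := emb_onto hA Ax.
by exists u; apply: emb_inj; rewrite gE ux.
Qed.

Lemma inC_ker X Y (A : set X) (B : set Y) (f : X -> Y) :
  linear f -> (forall x, A x -> B (f x)) -> inC A -> inC B ->
  inC (A `&` [set x | f x = 0]).
Proof.
move=> lf fAB [hA CA] [hB CB]; set K := _ `&` _.
have hK : is_submod K := is_submodI hA (is_submod_ker lf); exists hK.
have [g gE] := subm_lift hA hB lf fAB.
have [||k kE] := @subm_lift _ _ _ K A hK hA id; first by move=> a u v.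
  by move=> x [].
have [_ _ kerC] := hC.
apply: (kerC (subfg hA) (subfg hB) (subfg hK) g k) CA CB.
  by move=> u v /(congr1 (@emb _ _ _ _)); rewrite !kE => /emb_inj.
apply/seteqP; split=> [_ [u _ <-]|v /= gv0].
  apply: emb_inj => /=; rewrite gE kE emb0.
  by have [_] := emb_in u.
have [|u uv] := @emb_onto _ _ _ hK (emb v).
  by split; [exact: emb_in|rewrite /= -gE gv0 emb0].
by exists u => //; apply: emb_inj; rewrite kE.
Qed.

Lemma inC_ext X Y (A : set X) (f : X -> Y) : is_submod A ->
  linear f -> inC (A `&` [set x | f x = 0]) -> inC (f @` A) -> inC A.
Proof.
move=> hA lf [hK CK] [hB CB]; exists hA.
have [|g gE] := subm_lift hA hB lf; first by move=> x Ax; exists x.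
have [||k kE] := @subm_lift _ _ _ _ A hK hA id; first by move=> a u v.
  by move=> x [].
have [_ extC _] := hC.
apply: (extC (subfg hK) (subfg hA) (subfg hB) k g) CK CB.
- by move=> u v /(congr1 (@emb _ _ _ _)); rewrite !kE => /emb_inj.
- apply/seteqP; split=> [_ [u _ <-]|v /= gv0].
    apply: emb_inj => /=; rewrite gE kE emb0.
    by have [_] := emb_in u.
  have [|u uv] := @emb_onto _ _ _ hK (emb v).
    by split; [exact: emb_in|rewrite /= -gE gv0 emb0].
  by exists u => //; apply: emb_inj; rewrite kE.
- apply/seteqP; split=> // v _; have [x Ax xv] := emb_in v.
  have [u ux] := emb_onto hA Ax.
  by exists u => //; apply: emb_inj; rewrite gE ux.
Qed.

Lemma inC_range X Y (f : {linear X -> Y}) : injective f -> inC (range f) -> C X.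
Proof.
move=> fI [hB CB].
have lift (u : subm hB) : exists x, f x = emb u.
  by have [x _ xu] := emb_in u; exists x.
have [g gP] := choice lift.
have lg : linear g.
  by move=> a u v; apply: fI; rewrite linearP !gP emb_lin.
have [h hg] := linear_bundle lg; apply: (@ke_iso (subfg hB) X h) CB => [u v|x].
  by rewrite !hg => /(congr1 f); rewrite !gP => /emb_inj.
have [|u ux] := @emb_onto _ _ _ hB (f x); first by exists x.
by exists u; apply: fI; rewrite hg gP.
Qed.

(** A power of [X] is filtered by the families that vanish outside a list of
    indices; each step of the filtration is a copy of [X]. *)
Lemma inC_ffun (I : finType) X : C X -> inC [set: ffun_fg I X].
Proof.
move=> CX; pose A (s : seq I) : set (ffun_fg I X) :=
  [set f : {ffun I -> X} | forall i, i \notin s -> f i = 0].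
have -> : setT = A (enum I).
  by apply/seteqP; split=> // f _ i; rewrite mem_enum.
elim: (enum I) => [|i s IH].
  have -> : A [::] = [set 0]; last exact: inC0.
  apply/seteqP; split=> [f Af|f -> j _]; last by rewrite ffunE.
  by apply/ffunP => j; rewrite Af ?ffunE.
have [si|nsi] := boolP (i \in s).
  have -> : A (i :: s) = A s; last exact: IH.
  apply/seteqP; split=> f Af j js; apply: Af.
    by rewrite inE negb_or js andbT; apply: contraNneq js => ->.
  by move: js; rewrite inE negb_or => /andP[].
pose ev (f : ffun_fg I X) : X := (f : {ffun I -> X}) i.
have lev : linear ev by move=> a u v; rewrite /ev !ffunE.
apply: (inC_ext _ lev).
- split=> [j _|f g Af Ag j js|a f Af j js]; rewrite !ffunE // ?Af ?Ag //.
    by rewrite addr0.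
  by rewrite scaler0.
- have -> : A (i :: s) `&` [set x | ev x = 0] = A s; last exact: IH.
  apply/seteqP; split=> [f [Af fi] j js|f Af].
    by have [-> //|ji] := eqVneq j i; apply: Af; rewrite inE negb_or ji.
  split=> [j|]; last exact: Af.
  by rewrite inE negb_or => /andP[_]; exact: Af.
- have -> : ev @` A (i :: s) = setT; last exact: inCT.
  apply/seteqP; split=> // x _.
  exists [ffun j => if j == i then x else 0]; last by rewrite /ev ffunE eqxx.
  by move=> j; rewrite inE negb_or ffunE => /andP[/negbTE ->].
Qed.

End InSubcat.

Arguments fgmod_noeth {R} hR X.

(** * Primes, associated primes and regular elements *)

Section Primes.
Variable R : comPzRingType.
Implicit Types (p q : prime_ideal R) (r s t : R).

Lemma primeD p r s : prime_set p r -> prime_set p s -> prime_set p (r + s).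
Proof. by have [[_ pD _] _ _] := prime_setP p; exact: pD. Qed.

Lemma prime_mull p r s : prime_set p s -> prime_set p (r * s).
Proof. by have [[_ _ pZ] _ _] := prime_setP p; exact: pZ. Qed.

Lemma prime_addK p r s : prime_set p r -> prime_set p (r + s) -> prime_set p s.
Proof.
move=> pr prs; have -> : s = -1 * r + (r + s) by ring.
by apply: primeD => //; exact: prime_mull.
Qed.

Lemma prime_nM p r s :
  ~ prime_set p r -> ~ prime_set p s -> ~ prime_set p (r * s).
Proof. by have [_ _ pM] := prime_setP p => pr ps /pM[]. Qed.

Lemma prime_n1 p : ~ prime_set p 1.
Proof. by have [_ p1 _] := prime_setP p. Qed.

Lemma prime_nprod p (I : finType) (F : I -> R) :
  (forall i, ~ prime_set p (F i)) -> ~ prime_set p (\prod_i F i).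
Proof.
move=> pF; apply: (big_ind (fun r => ~ prime_set p r)) => //.
  exact: prime_n1.
by move=> r s; exact: prime_nM.
Qed.

Lemma is_submod_prime p : is_submod (p : set R^o).
Proof. by have [[p0 pD pZ] _ _] := prime_setP p. Qed.

Lemma common_denom p (I : finType) (P : I -> R -> Prop) :
  (forall i s t, P i s -> P i (t * s)) ->
  (forall i, exists2 s, ~ prime_set p s & P i s) ->
  exists2 s, ~ prime_set p s & forall i, P i s.
Proof.
move=> PM ex; have ex' i : exists s, ~ prime_set p s /\ P i s.
  by have [s ps Ps] := ex i; exists s.
have [d dP] := choice ex'; exists (\prod_i d i).
  by apply: prime_nprod => i; case: (dP i).
by move=> i; rewrite (bigD1 i) //= mulrC; apply: PM; case: (dP i).
Qed.

(** Prime avoidance for [Q 0, ..., Q (n-1)]. If [a] avoids the earlier primes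
    but lies in [q = Q n], it is corrected by an element [b] of [p] outside [q]
    that lies in every earlier prime not contained in [q]. *)
Lemma prime_avoidance p (Q : nat -> prime_ideal R) n :
  exists2 a, prime_set p a &
    forall i, (i < n)%N -> ~ (p `<=` Q i) -> ~ prime_set (Q i) a.
Proof.
elim: n => [|n [a pa aQ]]; first by exists 0 => //; case: (is_submod_prime p).
pose q := Q n.
have [pq|npq] := pselect (p `<=` q).
  by exists a => // i; rewrite ltnS leq_eqVlt => /predU1P[->|/aQ].
have [qa|nqa] := pselect (prime_set q a); last first.
  by exists a => // i; rewrite ltnS leq_eqVlt => /predU1P[->|/aQ].
have [b [pb qb bQ]] : exists b, [/\ prime_set p b, ~ prime_set q b &
    forall i, (i < n)%N -> ~ (Q i `<=` q) -> prime_set (Q i) b].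
  elim: (n) => [|m [b [pb qb bQ]]].
    have [c pc qc] : exists2 c, prime_set p c & ~ prime_set q c.
      apply: contrapT => no; apply: npq => c pc; apply: contrapT => qc.
      by apply: no; exists c.
    by exists c; split.
  have [mq|nmq] := pselect (Q m `<=` q).
    exists b; split=> // i; rewrite ltnS leq_eqVlt => /predU1P[->|/bQ] //.
  have [c mc qc] : exists2 c, prime_set (Q m) c & ~ prime_set q c.
    apply: contrapT => no; apply: nmq => c mc; apply: contrapT => qc.
    by apply: no; exists c.
  exists (c * b); split; [exact: prime_mull|exact: prime_nM|].
  move=> i; rewrite ltnS leq_eqVlt => /predU1P[-> _|/bQ ib iq].
    by rewrite mulrC; exact: prime_mull.
  by apply: prime_mull; exact: ib.
have nqab : ~ prime_set q (a + b) by move=> /(prime_addK qa).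
exists (a + b); first exact: primeD.
move=> i; rewrite ltnS leq_eqVlt => /predU1P[-> //|im npi].
have [iq|niq] := pselect (Q i `<=` q); first by move=> /iq.
by rewrite addrC => /(prime_addK (bQ _ im niq)); exact: aQ.
Qed.

End Primes.

Section AssociatedPrimes.
Variables (R : comPzRingType) (hR : noetherian R).
Implicit Types (p q : prime_ideal R) (r s t : R).

(** The class of [x] modulo [N] has annihilator [q], so that [N + Rx] modulo
    [N] is a copy of [R/q]. *)
Definition class_ann (M : lmodType R) (N : set M) (x : M) q : Prop :=
  forall t, prime_set q t <-> N (t *: x).

Lemma class_ann_notin (M : lmodType R) (N : set M) x q :
  class_ann N x q -> ~ N x.
Proof. by move=> qx Nx; apply: (@prime_n1 _ q); apply/qx; rewrite scale1r. Qed.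

Lemma class_ann_mul (M : lmodType R) (N : set M) x q r :
  is_submod N -> class_ann N x q -> ~ N (r *: x) -> class_ann N (r *: x) q.
Proof.
move=> [_ _ NZ] qx Nrx t; rewrite scalerA; split=> [qt|/qx].
  by rewrite mulrC -scalerA; apply: NZ; apply/qx.
have [_ _ qM] := prime_setP q => /qM[//|/qx //].
Qed.

(** Among the multiples of [y] outside [N], one whose annihilator modulo [N] is
    maximal has a prime annihilator. *)
Lemma class_ann_ex (M : lmodType R) (N : set M) (y : M) :
  is_submod N -> ~ N y -> exists r q, class_ann N (r *: y) q.
Proof.
move=> hN Ny; have [N0 ND NZ] := hN.
pose col (z : M) : set R^o := [set t | N (t *: z)].
have hcol z : is_submod (col z).
  split=> [|s t /= cs ct|s t /= ct]; rewrite /col /=.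
  - by rewrite scale0r.
  - by rewrite scalerDl; exact: ND.
  - by rewrite -scalerA; exact: NZ.
pose P (I : set R^o) := exists2 r, ~ N (r *: y) & I = col (r *: y).
have [|I [hI [r Nry Ir] Imax]] := @noeth_max R R^o P (noetherian_ideal hR).
  by exists (col (1 *: y)) => //; exists 1; rewrite // scale1r.
have primeI : [/\ is_ideal (I : set R), ~ I 1 &
    forall s t : R, I (s * t) -> I s \/ I t].
  split; first exact: hI.
    by rewrite Ir /col /= [1 *: _]scale1r.
  move=> s t Ist; have [It|nIt] := pselect (I t); first by right.
  left; rewrite Ir in Ist nIt.
  apply: (Imax (col ((t * r) *: y))) => //.
  - move=> u; rewrite Ir /col /= => Nu.
    have -> : u *: ((t * r) *: y) = t *: (u *: (r *: y)).
      by rewrite !scalerA; congr (_ *: _); ring.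
    exact: NZ.
  - by exists (t * r) => //; rewrite -scalerA.
  - by move: Ist; rewrite /col /= !scalerA mulrA.
exists r, (PrimeIdeal primeI) => t /=.
by rewrite {1}Ir.
Qed.

(** A nonzero multiple of [z] in [N + R z0] modulo [N] has the annihilator of
    [z0]; if there is none, [z] has the same annihilator modulo [N + R z0] as
    modulo [N]. Hence the associated primes of [N] are one of [z0] and those of
    the larger submodule [N + R z0]. The prime [p] serves as a default value
    of the sequence [Q]. *)
Lemma class_ann_finite (p : prime_ideal R) (M : lmodType R) (N : set M) :
  noeth_mod M -> is_submod N ->
  exists (Q : nat -> prime_ideal R) (n : nat), forall z q, class_ann N z q ->
    exists2 i, (i < n)%N & q = Q i :> set R.
Proof.
move=> noethM; move: N; apply: (noeth_ind noethM) => N hN IH.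
have [[y Ny]|all] := pselect (exists y, ~ N y); last first.
  by exists (fun=> p), 0%N => z q /class_ann_notin Nz; case: all; exists z.
have [r [q0 q0y]] := class_ann_ex hN Ny.
move: (r *: y) q0y => z0 q0z {r y Ny}.
have Nz0 := class_ann_notin q0z.
have [Q [n Qn]] := IH _ (is_submod_add_line z0 hN) (add_line_proper hN Nz0).
exists (fun i => if i is j.+1 then Q j else q0), n.+1 => z q qz.
have [[r [c Nrc] Nrz]|no] :=
  pselect (exists2 r, add_line N z0 (r *: z) & ~ N (r *: z)).
  exists 0%N => //.
  have Ncz : ~ N (c *: z0).
    by move=> Ncz; apply: Nrz; exact: submod_subK Ncz Nrc.
  have qrz := class_ann_mul hN qz Nrz; have q0cz := class_ann_mul hN q0z Ncz.
  have [_ _ NZ] := hN.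
  apply/seteqP; split=> t.
    move=> /qrz Ntr; apply/q0cz.
    have := submodB hN Ntr (NZ t _ Nrc).
    by rewrite -scalerBr opprB addrC subrK.
  move=> /q0cz Ntc; apply/qrz.
  by apply: submod_subK Ntc _ => //; rewrite -scalerBr; exact: NZ.
have [|i iN ->] := Qn z q; last by exists i.+1.
move=> t; split=> [/qz Ntz|Ltz]; first exact: sub_add_line.
by apply/qz; apply: contrapT => Ntz; apply: no; exists t.
Qed.

(** If no element of [p] is regular modulo [N], prime avoidance puts [p] inside
    an associated prime of [N], and then [p] annihilates a nonzero class. *)
Lemma regular_elt (M : lmodType R) (N : set M) p :
  noeth_mod M -> is_submod N ->
  (forall x, (forall r, prime_set p r -> N (r *: x)) -> N x) ->
  exists2 a, prime_set p a & forall x, N (a *: x) -> N x.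
Proof.
move=> noethM hN Np; have [Q [n Qn]] := class_ann_finite p noethM hN.
have [a pa aQ] := prime_avoidance p Q n; exists a => // x Nax.
apply: contrapT => Nx; have [r [q qx]] := class_ann_ex hN Nx.
have [i ilt qi] := Qn _ _ qx.
have qa : prime_set q a.
  by apply/qx; rewrite scalerA mulrC -scalerA; have [_ _] := hN; apply.
apply: (aQ i ilt); last by rewrite -qi.
rewrite -qi => pq; apply: (class_ann_notin qx); apply: Np => t /pq.
by move/qx.
Qed.

End AssociatedPrimes.

(** * Localization at a prime, elementwise *)

Section Saturation.
Variables (R : comPzRingType) (p : prime_ideal R).

(** The elements whose image in the localization lies in that of [N]. *)
Definition sat (M : lmodType R) (N : set M) : set M :=
  [set x | exists2 s, ~ prime_set p s & N (s *: x)].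

(** The kernel of the localization map. *)
Definition tors (M : lmodType R) : set M := sat [set 0].
Arguments tors M : clear implicits.

Lemma is_submod_sat (M : lmodType R) (N : set M) :
  is_submod N -> is_submod (sat N).
Proof.
move=> [N0 ND NZ]; split=> [|x y [s ps Ns] [t pt Nt]|a x [s ps Ns]].
- by exists 1; [exact: prime_n1|rewrite scaler0].
- exists (s * t); first exact: prime_nM.
  rewrite scalerDr; apply: ND; last by rewrite -scalerA; exact: NZ.
  by rewrite mulrC -scalerA; exact: NZ.
- by exists s => //; rewrite scalerA mulrC -scalerA; exact: NZ.
Qed.

Lemma is_submod_tors (M : lmodType R) : is_submod (tors M).
Proof. exact: is_submod_sat (is_submod0 M). Qed.

Lemma sub_sat (M : lmodType R) (N : set M) : N `<=` sat N.
Proof. by move=> x Nx; exists 1; rewrite ?scale1r //; exact: prime_n1. Qed.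

Lemma sat_cancel (M : lmodType R) (N : set M) s x :
  ~ prime_set p s -> sat N (s *: x) -> sat N x.
Proof.
by move=> ps [t pt Nt]; exists (t * s); [exact: prime_nM|rewrite -scalerA].
Qed.

Lemma tors_killed (M : lmodType R) : noeth_mod M ->
  exists2 s, ~ prime_set p s & forall x, tors M x -> s *: x = 0.
Proof.
move=> noethM.
have hker s : is_submod [set x : M | s *: x = 0].
  apply: is_submod_ker => a x y.
  by rewrite scalerDr !scalerA mulrC.
pose P (N : set M) := exists2 s, ~ prime_set p s & N = [set x | s *: x = 0].
have [|_ [_ [s ps ->] smax]] := @noeth_max _ _ P noethM.
  exists [set x | 1 *: x = 0]; first exact: hker.
  by exists 1 => //; exact: prime_n1.
exists s => // x [t pt tx]; apply: (smax _ (hker (s * t))).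
- by move=> y /= sy; rewrite mulrC -scalerA sy scaler0.
- by exists (s * t) => //; exact: prime_nM.
- by rewrite /= -scalerA tx scaler0.
Qed.

(** Let [N] be maximal among the proper submodules that are saturated at [p].
    Modulo [N], any [x] outside [N] generates [M] at [p], so the hypothesis
    gives [s *: x = r *: x] with [s] outside [p] and [r] in [p]; as [s - r] is
    outside [p], saturation puts [x] in [N]. *)
Lemma nakayama (M : lmodType R) (a b : R) : noeth_mod M ->
  prime_set p a -> prime_set p b ->
  (forall x : M, exists s u v, ~ prime_set p s /\ s *: x = a *: u + b *: v) ->
  forall x, tors M x.
Proof.
move=> noethM pa pb Mab x0; apply: contrapT => Tx0.
pose P N := (forall x : M, sat N x -> N x) /\ exists x, ~ N x.
have [|N [hN [Nsat [x Nx]] Nmax]] := @noeth_max _ _ P noethM.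
  exists (tors M); first exact: is_submod_tors.
  split; last by exists x0.
  by move=> x [s ps]; apply: sat_cancel.
have hL := is_submod_add_line x hN.
have full y : sat (add_line N x) y.
  apply: contrapT => Ly; apply: Nx.
  apply: (Nmax (sat (add_line N x))) => [|||]; first exact: is_submod_sat.
  - by apply: subset_trans (@sub_sat _ _); exact: sub_add_line.
  - split; last by exists y.
    by move=> z [s ps]; apply: sat_cancel.
  - by apply: sub_sat; exact: mem_add_line.
have [s [u [v [ps sx]]]] := Mab x.
have [t pt [c Nu]] := full u; have [t' pt' [c' Nv]] := full v.
have [_ ND NZ] := hN.
apply: Nx; apply: Nsat.
have E : (t * t' * s) *: x = (a * t') *: (t *: u) + (b * t) *: (t' *: v).
  rewrite -scalerA sx scalerDr !scalerA.
  by congr (_ *: _ + _ *: _); ring.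
exists (t * t' * s - (a * t' * c + b * t * c')).
  move=> pd; apply: (prime_nM (prime_nM pt pt') ps).
  rewrite -[X in prime_set p X](subrK (a * t' * c + b * t * c')).
  apply: (primeD pd); apply: primeD.
    by rewrite -mulrA mulrC; exact: prime_mull.
  by rewrite -mulrA mulrC; exact: prime_mull.
rewrite scalerBl E scalerDl opprD addrACA.
by apply: ND; rewrite -[X in _ - X]scalerA -scalerBr; exact: NZ.
Qed.

End Saturation.

Arguments tors {R} p M.

(** * Depth at most one in terms of elements *)

Section SeqMul.
Variables (A : comPzRingType) (M : lmodType A).
Implicit Types (a b : A) (m : M).

Lemma seq_mul0 m : seq_mul [::] m <-> m = 0.
Proof.
split=> [[f ->]|->]; first by rewrite big_ord0.
by exists (fun=> 0); rewrite big_ord0.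
Qed.

Lemma seq_mul1 a m : seq_mul [:: a] m <-> exists u, m = a *: u.
Proof.
split=> [[f ->]|[u ->]].
  by exists (f ord0); rewrite big_ord_recl big_ord0 addr0.
by exists (fun=> u); rewrite big_ord_recl big_ord0 addr0.
Qed.

Lemma seq_mul2 a b m :
  seq_mul [:: a; b] m <-> exists u v, m = a *: u + b *: v.
Proof.
split=> [[f ->]|[u [v ->]]].
  exists (f ord0), (f (lift ord0 ord0)).
  by rewrite big_ord_recl big_ord_recl big_ord0 addr0.
exists (fun i => if i == ord0 then u else v).
by rewrite big_ord_recl big_ord_recl big_ord0 addr0.
Qed.

Lemma seq_mul_prefix a b (l : seq A) m :
  seq_mul [:: a; b] m -> seq_mul [:: a, b & l] m.
Proof.
move=> /seq_mul2[u [v ->]].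
exists (fun i => if i == ord0 then u else
                 if i == lift ord0 ord0 then v else 0).
rewrite big_ord_recl big_ord_recl big1 /= => [|i _]; last by rewrite scaler0.
by rewrite addr0.
Qed.

End SeqMul.

Section DepthOne.
Variables (R : comPzRingType) (p : prime_ideal R) (X : lmodType R).
Implicit Types (a b : R) (x : X).

(** The images of [a], [b] form a regular sequence on the localization of [X].
    The last condition says that they do not generate all of it. *)
Definition loc_regular2 a b : Prop :=
  [/\ prime_set p a, prime_set p b,
      forall x, tors p X (a *: x) -> tors p X x,
      forall x, sat p (range ( *:%R a)) (b *: x) -> sat p (range ( *:%R a)) x &
      exists x, ~ exists s u v, ~ prime_set p s /\ s *: x = a *: u + b *: v].

Lemma denN (d : denom p) : ~ prime_set p (den d).
Proof. by move=> /mem_set; apply/negP; exact: denomP. Qed.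

Lemma den_ex (s : R) : ~ prime_set p s -> exists d : denom p, den d = s.
Proof.
move=> ps; have /negP sp : ~ s \in prime_set p by move=> /set_mem.
by exists (Denom sp).
Qed.

Lemma loc_frac0 x (d : denom p) : loc_frac x d = 0 <-> tors p X x.
Proof.
have -> : 0 = loc_frac (0 : X) (denom1 p) by [].
rewrite loc_fracP; split=> [[u]|[s /den_ex[u <-] ux]].
  by rewrite !scaler0 scale1r => ux; exists (den u) => //; exact: denN.
by exists u; rewrite !scaler0 scale1r.
Qed.

Lemma loc_fracZE a (s : denom p) x (t : denom p) :
  loc_ofrac a s *: loc_frac x t = loc_frac (a *: x) (denomM s t).
Proof. exact: loc_fracZ. Qed.

Lemma loc_mul1 a (s t : denom p) x :
  (exists u : loc_mod p X, loc_frac x t = loc_ofrac a s *: u) <->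
  sat p (range ( *:%R a)) x.
Proof.
split=> [[u]|[_ /den_ex[c <-] [y _ cx]]].
  have [y [w ->]] := loc_frac_ex u; rewrite loc_fracZE loc_fracP => -[d].
  rewrite !scalerA /= => dE; exists (den d * (den s * den w)).
    by apply: prime_nM; [exact: denN|apply: prime_nM; exact: denN].
  exists ((den d * den t) *: y); rewrite // dE !scalerA.
  by congr (_ *: _); ring.
exists (loc_frac (den s *: y) (denomM c t)); rewrite loc_fracZE.
apply: loc_frac_eq => /=; have -> : den s * (den c * den t) =
  den s * den t * den c by ring.
by rewrite -scalerA -cx !scalerA; congr (_ *: _); ring.
Qed.

Lemma loc_mul2 a b (s s' t : denom p) x :
  (exists u v : loc_mod p X,
     loc_frac x t = loc_ofrac a s *: u + loc_ofrac b s' *: v) <->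
  exists c u v, ~ prime_set p c /\ c *: x = a *: u + b *: v.
Proof.
split=> [[u [v]]|[_ [y [z [/den_ex[c <-] cx]]]]].
  have [y [w ->]] := loc_frac_ex u; have [z [w' ->]] := loc_frac_ex v.
  rewrite !loc_fracZE loc_frac_add loc_fracP => -[d].
  rewrite !(scalerDr, scalerA) /= => dE.
  exists (den d * (den s * den w * (den s' * den w'))).
  exists ((den d * den t * (den s' * den w')) *: y).
  exists ((den d * den t * (den s * den w)) *: z).
  split.
    apply: prime_nM; first exact: denN.
    exact: prime_nM (@denN (denomM s w)) (@denN (denomM s' w')).
  by rewrite dE !scalerA; congr (_ *: _ + _ *: _); ring.
exists (loc_frac (den s *: y) (denomM c t)).
exists (loc_frac (den s' *: z) (denomM c t)).
rewrite !loc_fracZE loc_frac_add; apply: loc_frac_eq => /=.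
have -> : den s * (den c * den t) * (den s' * (den c * den t)) =
  den s * den t * (den s' * (den c * den t)) * den c by ring.
rewrite -scalerA cx !(scalerDr, scalerA).
by congr (_ *: _ + _ *: _); ring.
Qed.

Lemma regular_seq2 a b (s s' : denom p) (l : seq (loc_ring p)) :
  prime_set p a -> prime_set p b ->
  @regular_seq _ (loc_mod p X) [:: loc_ofrac a s, loc_ofrac b s' & l] ->
  loc_regular2 a b.
Proof.
move=> pa pb [reg nT]; split=> // [x ax|x bx|].
- have := reg 0%N isT (loc_frac x (denom1 p)); rewrite /= ?take0 !seq_mul0.
  by rewrite loc_fracZE !loc_frac0; exact.
- have := reg 1%N isT (loc_frac x (denom1 p)); rewrite /= ?take0 !seq_mul1.
  by rewrite loc_fracZE !loc_mul1; exact.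
- apply: contrapT => all; apply: nT; apply/seteqP; split=> // m _.
  have [x [t ->]] := loc_frac_ex m; apply: seq_mul_prefix.
  apply/seq_mul2/loc_mul2; apply: contrapT => nx; apply: all.
  by exists x.
Qed.

Lemma loc_regular2_seq a b : loc_regular2 a b ->
  @regular_seq _ (loc_mod p X)
    [:: loc_ofrac a (denom1 p); loc_ofrac b (denom1 p)].
Proof.
move=> [pa pb ra rb [x0 x0P]]; split=> [[|[|//]] _ m|T].
- have [x [t ->]] := loc_frac_ex m; rewrite /= ?take0 !seq_mul0.
  by rewrite loc_fracZE !loc_frac0; exact: ra.
- have [x [t ->]] := loc_frac_ex m; rewrite /= !seq_mul1.
  by rewrite loc_fracZE !loc_mul1; exact: rb.
- apply: x0P; apply/(loc_mul2 _ _ (denom1 p) (denom1 p) (denom1 p)).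
  by apply/seq_mul2; rewrite T.
Qed.

Lemma nonunitsP a (s : denom p) :
  loc_ofrac a s \in @nonunits (loc_ring p) <-> prime_set p a.
Proof.
split=> [/set_mem nu|pa].
  by apply: contrapT => pa; apply: nu; apply/loc_ofrac_unitP.
by apply: mem_set => /loc_ofrac_unitP.
Qed.

Lemma supp_tors : supp X p <-> exists x, ~ tors p X x.
Proof.
split=> [[m]|[x Tx]].
  have [x [t ->]] := loc_frac_ex m => /eqP m0; exists x.
  by move=> /(loc_frac0 x t).
by exists (loc_frac x (denom1 p)); apply/eqP => /loc_frac0.
Qed.

(** A regular sequence of length at least two may be truncated to its first two
    terms, whose denominators are units. *)
Lemma depth_le1P : supp X p ->
  (@depth (loc_ring p) (loc_mod p X) <= 1)%E <->
  ~ exists a b, loc_regular2 a b.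
Proof.
move=> supX; rewrite /depth; set S := [set _ | n in _].
split=> [le1 [a [b reg]]|nreg].
  have S2 : S 2%:E.
    exists 2%N => //.
    exists [:: loc_ofrac a (denom1 p); loc_ofrac b (denom1 p)].
    split=> //; last exact: loc_regular2_seq.
    case: reg => pa pb _ _ _ c; rewrite in_cons mem_seq1.
    by move=> /orP[]/eqP ->; apply/nonunitsP.
  move: le1; rewrite /supremum ifF; last by apply/eqP => S0; rewrite S0 in S2.
  case: xgetP => [y -> [/(_ _ S2) y2 _]|_].
    by move=> /(le_trans y2).
  by [].
have S0 : S 0%:E.
  exists 0%N => //; exists [::]; split=> //; split=> // T.
  have [m /eqP m0] := supX; apply: m0; apply/seq_mul0.
  by rewrite T.
have Sle n : S n -> n = 0%E \/ n = 1%E.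
  move=> [k [l [<- ln [reg nT]]] <-].
  case: l ln reg nT => [|c [|d l]] ln reg nT; [by left|by right|].
  case: nreg; have [a [s cE]] := loc_ring_ex c.
  have [b [t dE]] := loc_ring_ex d.
  exists a, b; apply: (@regular_seq2 a b s t l).
  - by apply/(nonunitsP a s); apply: ln; rewrite cE inE eqxx.
  - by apply/(nonunitsP b t); apply: ln; rewrite dE !inE eqxx orbT.
  - by rewrite -cE -dE.
rewrite /supremum ifF; last by apply/eqP => S00; rewrite S00 in S0.
(* The least upper bound has to be exhibited: [supremum] falls back on [+oo]
   when there is none. *)
have ub1 : ubound S 1%E by move=> n /Sle[] ->.
case: xgetP => [y _ [_ ylb]|]; first exact: ylb.
have [S1|nS1] := pselect (S 1%E).
  by move=> /(_ 1%E); case; split=> // n; apply.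
move=> /(_ 0%E); case; split; first by move=> n /[dup] /Sle[-> //|-> /nS1].
by move=> n; apply.
Qed.

End DepthOne.

(** * The modules of depth at least two at a prime *)

Section DepthTwo.
Variables (R : comPzRingType) (p : prime_ideal R) (a b : R).
Implicit Types X Y Z K : lmodType R.

(** Vanishing, after localization at [p], of the Koszul cohomology of [Y] on
    [a], [b] in degrees 0 and 1. Equivalently, at [p] each pair [(y, z)] with
    [a *: z = b *: y] is [(a *: w, b *: w)] for a unique [w]; for a map between
    two such modules, uniqueness in the target puts the [w] of a pair of
    elements of the kernel into the kernel, whence KE-closedness. *)
Definition depth_ge2 Y : Prop :=
  (forall w : Y, a *: w = 0 -> b *: w = 0 -> tors p Y w) /\
  (forall y z : Y, a *: z = b *: y ->
     exists v w, [/\ ~ prime_set p v, v *: y = a *: w & v *: z = b *: w]).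

Lemma depth_ge2_ext X Y Z (f : {linear X -> Y}) (g : {linear Y -> Z}) :
  injective f -> range f = [set y | g y = 0] -> range g = setT ->
  depth_ge2 X -> depth_ge2 Z -> depth_ge2 Y.
Proof.
move=> fI fg gS [X0 X1] [Z0 Z1].
have lift y : g y = 0 -> exists x, f x = y.
  move=> gy; have : [set y | g y = 0] y by [].
  by rewrite -fg => -[x _]; exists x.
split=> [w aw bw|y z azby].
  have [||s ps gsw] := Z0 (g w); rewrite -?linearZ_LR ?aw ?bw ?linear0 //.
  have [x xE] : exists x, f x = s *: w by apply: lift; rewrite linearZ_LR.
  have [||t pt tx] := X0 x.
  - apply: fI; rewrite linear0 linearZ_LR xE.
    by rewrite scalerA mulrC -scalerA aw scaler0.
  - apply: fI; rewrite linear0 linearZ_LR xE.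
    by rewrite scalerA mulrC -scalerA bw scaler0.
  exists (t * s); first exact: prime_nM.
  by rewrite /= -scalerA -xE -linearZ_LR tx linear0.
have [|v [w0 [pv vy vz]]] := Z1 (g y) (g z); first by rewrite -!linearZ_LR azby.
have [w _ wE] : range g w0 by rewrite gS.
have [x1 x1E] : exists x, f x = v *: y - a *: w.
  by apply: lift; rewrite linearB 2!linearZ_LR wE vy subrr.
have [x2 x2E] : exists x, f x = v *: z - b *: w.
  by apply: lift; rewrite linearB 2!linearZ_LR wE vz subrr.
have [|v' [x0 [pv' v'x1 v'x2]]] := X1 x1 x2.
  apply: fI; rewrite 2!linearZ_LR x1E x2E !scalerBr !scalerA.
  congr (_ - _ *: _).
    by rewrite ![_ * v]mulrC -!scalerA azby.
  by rewrite mulrC.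
exists (v' * v), (v' *: w + f x0); split; first exact: prime_nM.
  rewrite scalerDr -(linearZ_LR f) -v'x1 (linearZ_LR f) x1E scalerBr !scalerA.
  by rewrite [a * v']mulrC addrC subrK.
rewrite scalerDr -(linearZ_LR f) -v'x2 (linearZ_LR f) x2E scalerBr !scalerA.
by rewrite [b * v']mulrC addrC subrK.
Qed.

Lemma depth_ge2_ker X Y K (f : {linear X -> Y}) (k : {linear K -> X}) :
  injective k -> range k = [set x | f x = 0] ->
  depth_ge2 X -> depth_ge2 Y -> depth_ge2 K.
Proof.
move=> kI kf [X0 X1] [Y0 _]; split=> [w aw bw|y z azby].
  have [||s ps skw] := X0 (k w); rewrite -?linearZ_LR ?aw ?bw ?linear0 //.
  by exists s => //; apply: kI; rewrite linearZ_LR linear0.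
have fk x : f (k x) = 0 by have : range k (k x) by []; rewrite kf.
have [|v [w [pv vy vz]]] := X1 (k y) (k z); first by rewrite -!linearZ_LR azby.
have [||s ps sfw] := Y0 (f w).
- by rewrite -linearZ_LR -vy linearZ_LR fk scaler0.
- by rewrite -linearZ_LR -vz linearZ_LR fk scaler0.
have [w' _ w'E] : range k (s *: w) by rewrite kf /= linearZ_LR.
exists (s * v), w'; split; first exact: prime_nM.
  by apply: kI; rewrite !linearZ_LR w'E -scalerA vy !scalerA mulrC.
by apply: kI; rewrite !linearZ_LR w'E -scalerA vz !scalerA mulrC.
Qed.

Lemma depth_ge2_0 X : (forall x : X, x = 0) -> depth_ge2 X.
Proof.
move=> X0; split=> [w _ _|y z _].
  by rewrite (X0 w); case: (is_submod_tors p X).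
exists 1, 0; split; rewrite ?scale1r ?scaler0 //; exact: prime_n1.
Qed.

Lemma depth_ge2_iso X Y (f : {linear X -> Y}) :
  bijective f -> depth_ge2 X -> depth_ge2 Y.
Proof.
move=> [g fK gK] [X0 X1]; have fI := can_inj fK; split=> [w|y z].
  rewrite -(gK w); move: (g w) => {}w aw bw.
  have [||s ps sw] := X0 w.
  - by apply: fI; rewrite linear0 linearZ_LR.
  - by apply: fI; rewrite linear0 linearZ_LR.
  by exists s; rewrite //= -linearZ_LR sw linear0.
rewrite -(gK y) -(gK z); move: (g y) (g z) => {}y {}z azby.
have [|v [w [pv vy vz]]] := X1 y z; first by apply: fI; rewrite !linearZ_LR.
by exists v, (f w); rewrite -!linearZ_LR vy vz.
Qed.

Lemma depth_ge2_prod X Y : depth_ge2 X -> depth_ge2 Y -> depth_ge2 (X * Y)%type.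
Proof.
pose i (x : X) : (X * Y)%type := (x, 0).
have li : linear i by move=> c u v; congr (_, _); rewrite /= scaler0 addr0.
pose pr (w : (X * Y)%type) : Y := w.2.
have lpr : linear pr by move=> c u v.
have [f fE] := linear_bundle li; have [g gE] := linear_bundle lpr.
apply: (@depth_ge2_ext X (X * Y)%type Y f g).
- by move=> x x'; rewrite !fE => -[].
- apply/seteqP; split=> [_ [x _ <-]|[x y]] /=; first by rewrite gE fE.
  by rewrite gE /pr /= => ->; exists x; rewrite ?fE.
- by apply/seteqP; split=> // y _; exists (0, y); rewrite ?gE.
Qed.

Definition depth_ge2_subcat : subcat R :=
  fun Y : fgmod R => depth_ge2 Y.

Lemma depth_ge2_ke : ke R depth_ge2_subcat.
Proof.
split=> [|X Y Z f g|X Y K f k]; last 2 first.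
- exact: depth_ge2_ext.
- exact: depth_ge2_ker.
split=> [X Y f|X|X Y Z f fB CX CY].
- exact: depth_ge2_iso.
- exact: depth_ge2_0.
- exact: depth_ge2_iso fB (depth_ge2_prod CX CY).
Qed.

Lemma loc_regular2_depth_ge2 X : loc_regular2 p X a b -> depth_ge2 X.
Proof.
move=> [pa pb ra rb _]; have [T0 TD TZ] := is_submod_tors p X.
split=> [w aw _|y z azby]; first by apply: ra; rewrite aw.
have [|s ps [w _ wE]] := rb y.
  by apply: sub_sat; exists z.
have [t pt tE] : tors p X (s *: z - b *: w).
  apply: ra; rewrite scalerBr !scalerA [a * s]mulrC [a * b]mulrC -!scalerA.
  by rewrite azby wE !scalerA [s * b]mulrC subrr.
exists (t * s), (t *: w); split; first exact: prime_nM.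
  by rewrite -scalerA -wE !scalerA mulrC.
move: tE => /= /eqP; rewrite scalerBr subr_eq0 !scalerA => /eqP ->.
by rewrite mulrC.
Qed.

End DepthTwo.

(** If [a X + b X] also had depth at least two, comparing the pairs
    [(a x, b x)] inside it with [x] itself would put [x] in [a X + b X] up to
    torsion, against the regularity of [a], [b] on [X]. *)
Lemma ke_torf_no_regular (R : comPzRingType) (hR : noetherian R)
    (X : fgmod R) (p : prime_ideal R) (a b : R) :
  ke R = torf R -> ~ loc_regular2 p X a b.
Proof.
move=> eqC reg; have [_ _ _ _ [x Xab]] := reg.
have := depth_ge2_ke p a b; rewrite eqC => -[_ _ subC].
pose S : set X := [set y | exists u v, y = a *: u + b *: v].
have hS : is_submod S.
  split=> [|_ _ [u [v ->]] [u' [v' ->]]|c _ [u [v ->]]].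
  - by exists 0, 0; rewrite !scaler0 addr0.
  - by exists (u + u'), (v + v'); rewrite !scalerDr addrACA.
  - by exists (c *: u), (c *: v); rewrite scalerDr !scalerA ![c * _]mulrC.
have [X0 X1] := loc_regular2_depth_ge2 reg.
have [e eE] := linear_bundle (@emb_lin _ _ _ hS).
have [_ S1] : depth_ge2 p a b (subm hS).
  apply: (subC (subfg hR hS) X e); last exact: loc_regular2_depth_ge2.
  by move=> u v; rewrite !eE => /emb_inj.
have [y yE] : exists y : subm hS, emb y = a *: x.
  by apply: emb_onto; exists x, 0; rewrite scaler0 addr0.
have [z zE] : exists y : subm hS, emb y = b *: x.
  by apply: emb_onto; exists 0, x; rewrite scaler0 add0r.
have [|v [w [pv vy vz]]] := S1 y z.
  by apply: emb_inj; rewrite !(linZ (@emb_lin _ _ _ hS)) yE zE !scalerA mulrC.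
have [||s ps sE] := X0 (v *: x - emb w).
- rewrite scalerBr scalerA [a * v]mulrC -scalerA -yE.
  by rewrite -!(linZ (@emb_lin _ _ _ hS)) vy subrr.
- rewrite scalerBr scalerA [b * v]mulrC -scalerA -zE.
  by rewrite -!(linZ (@emb_lin _ _ _ hS)) vz subrr.
have [u1 [u2 wE]] := emb_in w.
apply: Xab; exists (s * v), (s *: u1), (s *: u2); split; first exact: prime_nM.
move: sE => /= /eqP; rewrite scalerBr subr_eq0 -[(s * v) *: x]scalerA.
move=> /eqP ->.
by rewrite wE scalerDr !scalerA ![s * _]mulrC.
Qed.

(** * Kernels of maps to the cyclic modules R/p *)

Section CyclicQuotients.
Variables (R : comPzRingType) (hR : noetherian R).
Variables (C : subcat R) (hC : ke R C).
Implicit Types (X Y Z : fgmod R) (p q : prime_ideal R).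

Local Notation inC := (inC hR C).

(** With [N = M + R x] and [class_ann M x p], the submodule [M] is the kernel of
    a surjection of [N] onto [R/p]. *)
Definition cyc_ker p : Prop :=
  forall X (M N : set X) (x : X), is_submod M -> M `<=` N -> N x ->
  N `<=` add_line M x -> class_ann M x p -> inC N -> inC M.

(** The filtration of [W/M] with cyclic quotients [R/q] reaches [M] from [W]
    in finitely many steps; each [q] contains the annihilator of [W/M]. *)
Lemma inC_descend X (W M : set X) : inC W -> is_submod M -> M `<=` W ->
  (forall q, (forall r, (forall w, W w -> M (r *: w)) -> prime_set q r) ->
     cyc_ker q) ->
  inC M.
Proof.
move=> CW; move: M; have hW := inC_submod CW.
apply: (noeth_ind (fgmod_noeth hR X)) => M hM IH MW cycM.
have [[y Wy My]|all] := pselect (exists2 y, W y & ~ M y); last first.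
  have -> // : M = W; apply/seteqP; split=> // y Wy.
  by apply: contrapT => My; apply: all; exists y.
have [r [q qx]] := class_ann_ex hR hM My.
have Wx : W (r *: y) by case: hW => _ _; apply.
move: (r *: y) qx Wx => x qx Wx {r y Wy My}.
have Mx := class_ann_notin qx.
have LW := add_line_sub hW MW Wx.
have CN : inC (add_line M x).
  apply: (IH _ (is_submod_add_line x hM) (add_line_proper hM Mx)) => // q' q'P.
  by apply: cycM => t tW; apply: q'P => w /tW; exact: sub_add_line.
have cq : cyc_ker q by apply: cycM => t tW; apply/qx; exact: tW.
by apply: (cq X M _ x hM _ _ _ qx CN) => //;
  [exact: sub_add_line|exact: mem_add_line].
Qed.

(** Let [N] map onto [R/p] with kernel [M], and let [W/Y] contain a copy of
    [R/p]. The fibre product [P] over [R/p] of [N] with the preimage of this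
    copy in [W] is an extension of [N] by [Y], hence in [C], and [M] is the
    kernel of the projection from [P] to [W]. *)
Lemma cyc_ker_of_class p Z (Y W : set Z) (z : Z) :
  inC Y -> inC W -> Y `<=` W -> W z -> class_ann Y z p -> cyc_ker p.
Proof.
move=> CY CW YW Wz pz X M N x hM MN Nx NM px CN.
have hN := inC_submod CN; have hY := inC_submod CY; have hW := inC_submod CW.
have [M0 MD MZ] := hM; have [Y0 YD YZ] := hY; have [_ _ WZ] := hW.
have [_ _ NZ] := hN.
pose P : set (prod_fg X Z) :=
  [set w : (X * Z)%type | exists r, M (w.1 - r *: x) /\ Y (w.2 - r *: z)].
have hP : is_submod P.
  split=> [|[u v] [u' v'] [r [Mr Yr]] [s [Ms Ys]]|a [u v] [r [Mr Yr]]] /=.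
  - by exists 0; rewrite !scale0r !subr0.
  - by exists (r + s); rewrite !scalerDl !opprD; split; rewrite addrACA;
      [exact: MD|exact: YD].
  - by exists (a * r); rewrite -!scalerA -!scalerBr; split;
      [exact: MZ|exact: YZ].
pose f1 (w : prod_fg X Z) : X := (w : (X * Z)%type).1.
pose f2 (w : prod_fg X Z) : Z := (w : (X * Z)%type).2.
pose i2 (v : Z) : prod_fg X Z := ((0, v) : (X * Z)%type).
have lf1 : linear f1 by [].
have lf2 : linear f2 by [].
have li2 : linear i2 by move=> a u v; congr (_, _); rewrite /= scaler0 addr0.
have CP : inC P.
  apply: (inC_ext hC hP lf1).
    have -> : P `&` [set w | f1 w = 0] = i2 @` Y.
      apply/seteqP; split=> [[u v] [[r [/= Mr Yr]] u0]|_ [v Yv <-]].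
        rewrite /f1 /= in u0; subst u; exists v => //.
        have pr : prime_set p r.
          by apply/px; have := submodB hM M0 Mr; rewrite sub0r opprB subr0.
        by apply: (submod_subK hY _ Yr); apply/pz.
      by split=> //; exists 0; rewrite /= !scale0r !subr0.
    by apply: (inC_image hC li2) CY => v _ [].
  have -> // : f1 @` P = N.
  apply/seteqP; split=> [_ [[u v] [r [/= Mr _]] <-]|u /[dup] Nu /NM[r Mr]].
    by apply: (submod_subK hN _ (MN _ Mr)); exact: NZ.
  by exists (u, r *: z) => //; exists r; rewrite /= subrr.
have PW w : P w -> W (f2 w).
  by case: w => u v [r [_ /= /YW Wr]]; apply: (submod_subK hW _ Wr); exact: WZ.
have CK := inC_ker hC lf2 PW CP CW.
have -> : M = f1 @` (P `&` [set w | f2 w = 0]).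
  apply/seteqP; split=> [u Mu|_ [[u v] [[r [/= Mr Yr]] v0] <-]].
    exists (u, 0) => //; split=> //; exists 0.
    by rewrite /= !scale0r !subr0.
  rewrite /f2 /= in v0; subst v; apply: (submod_subK hM _ Mr); apply/px/pz.
  by have := submodB hY Y0 Yr; rewrite sub0r opprB subr0.
apply: (inC_image hC lf1) CK => -[u v] [_ v0] u0.
by rewrite /f1 /f2 /= in v0 u0 *; rewrite v0 u0.
Qed.

(** * The Koszul cocycles of an ideal *)

(** Stating the generation of [I] by its action on modules avoids products of
    ideals and submodules. *)
Lemma ideal_gens (I : set R^o) : is_submod I ->
  exists (n : nat) (g : 'I_n -> R), (forall i, I (g i)) /\
    forall (M : lmodType R) (N : set M) (x : M), is_submod N ->
      (forall i, N (g i *: x)) -> forall r, I r -> N (r *: x).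
Proof.
move=> hI; have [n [g Ig]] := hR hI; exists n, g; split=> [i|M N x hN Ng r].
  rewrite Ig; exists (fun j => (j == i)%:R).
  rewrite (bigD1 i) //= eqxx mul1r big1 ?addr0 // => j /negbTE ->.
  by rewrite mul0r.
rewrite Ig => -[c ->]; rewrite scaler_suml; apply: submod_sum => // i.
by rewrite -scalerA; have [_ _] := hN; apply.
Qed.

Section Koszul.
Variables (X : fgmod R) (n : nat) (g : 'I_n -> R).

Definition koszul_d (x : X) : ffun_fg 'I_n X :=
  ([ffun i => g i *: x] : {ffun 'I_n -> X}).

Definition cocycles : set (ffun_fg 'I_n X) :=
  [set f : {ffun 'I_n -> X} | forall i j, g i *: f j = g j *: f i].

Lemma koszul_d_lin : linear koszul_d.
Proof.
move=> a u v; apply/ffunP => i; rewrite !ffunE scalerDr !scalerA.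
by rewrite mulrC.
Qed.

Lemma koszul_d_cocycle x : cocycles (koszul_d x).
Proof. by move=> i j; rewrite !ffunE !scalerA mulrC. Qed.

Lemma koszul_d_eq0 x : koszul_d x = 0 <-> forall i, g i *: x = 0.
Proof.
split=> [d0 i|g0]; last by apply/ffunP => i; rewrite !ffunE g0.
by have := congr1 (fun f : {ffun 'I_n -> X} => f i) d0; rewrite !ffunE.
Qed.

(** The ideal generated by the [g i] annihilates the cohomology. *)
Lemma cocycle_scale f i : cocycles f ->
  g i *: f = koszul_d ((f : {ffun 'I_n -> X}) i).
Proof. by move=> cf; apply/ffunP => j; rewrite !ffunE (cf i j). Qed.

Lemma inC_cocycles : C X -> inC cocycles.
Proof.
move=> CX; pose d (f : ffun_fg 'I_n X) : ffun_fg ('I_n * 'I_n)%type X :=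
  ([ffun ij => g ij.1 *: (f : {ffun 'I_n -> X}) ij.2
             - g ij.2 *: (f : {ffun 'I_n -> X}) ij.1]
    : {ffun ('I_n * 'I_n) -> X}).
have ld : linear d.
  move=> a u v; apply/ffunP => ij; rewrite !ffunE !scalerDr !scalerA.
  by rewrite ![_ * a]mulrC -!scalerA scalerN opprD addrACA.
have -> : cocycles = setT `&` [set f | d f = 0].
  apply/seteqP; split=> [f cf|f [_ df] i j].
    by split=> //; apply/ffunP => ij; rewrite !ffunE cf subrr.
  have := congr1 (fun h : {ffun ('I_n * 'I_n) -> X} => h (i, j)) df.
  by rewrite !ffunE /= => /eqP; rewrite subr_eq0 => /eqP.
apply: (inC_ker hC ld (B := setT)) => //; exact: inC_ffun.
Qed.

Lemma inC_koszul_im : C X -> (forall x, koszul_d x = 0 -> x = 0) ->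
  inC (range koszul_d).
Proof.
move=> CX d0; apply: (inC_image hC koszul_d_lin) (inCT hR hC CX) => x _.
exact: d0.
Qed.

End Koszul.

Lemma is_submod_koszul_im X n (g : 'I_n -> R) :
  is_submod (range (koszul_d (X := X) g)).
Proof. exact: is_submod_image (koszul_d_lin _) _ (is_submodT X). Qed.

(** Depth sensitivity of the Koszul complex. Suppose that [p] kills no
    nonzero element and that every cocycle is a coboundary at [p]. Then [p]
    contains an element [a] regular at [p]. Moreover [p] kills no nonzero
    element modulo [a] at [p]: if [g i *: x = a *: v i], then [v] is a cocycle,
    hence [v i = g i *: w], and [x = a *: w]. So [a] is followed by a second
    regular element. *)
Lemma noncoboundary_ex X p n (g : 'I_n -> R) :
  (forall i, prime_set p (g i)) ->
  (forall (M : lmodType R) (N : set M) (x : M), is_submod N ->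
     (forall i, N (g i *: x)) -> forall r, prime_set p r -> N (r *: x)) ->
  (forall x : X, (forall r, prime_set p r -> r *: x = 0) -> x = 0) ->
  (exists x, ~ tors p X x) ->
  ~ (exists a b, loc_regular2 p X a b) ->
  exists2 w, cocycles (X := X) g w & ~ sat p (range (koszul_d g)) w.
Proof.
move=> pg gP p0 [x0 Tx0] nreg; apply: contrapT => noex.
have cob w : cocycles (X := X) g w -> sat p (range (koszul_d g)) w.
  by move=> cw; apply: contrapT => nw; apply: noex; exists w.
have noethX := fgmod_noeth hR X.
have [s ps sT] := tors_killed p noethX.
have T0 (x : X) : (forall r, prime_set p r -> tors p X (r *: x)) -> tors p X x.
  move=> Tpx; exists s => //=; apply: p0 => r pr.
  by rewrite scalerA mulrC -scalerA; apply: sT; exact: Tpx.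
have [a pa ra] := regular_elt hR noethX (is_submod_tors p X) T0.
have la : linear ( *:%R a : X -> X).
  by move=> c u v; rewrite scalerDr !scalerA mulrC.
have haX := is_submod_image la (is_submodT X).
have aX0 (x : X) :
    (forall r, prime_set p r -> sat p (range ( *:%R a)) (r *: x)) ->
    sat p (range ( *:%R a)) x.
  move=> apx.
  have [||t pt tP] := @common_denom R p 'I_n
      (fun i t => range ( *:%R a) (t *: (g i *: x))).
  - by move=> i t t' Pt; rewrite -scalerA; have [_ _] := haX; apply.
  - by move=> i; apply: apx.
  have lift i : exists v, a *: v = t *: (g i *: x).
    by have [v _ vE] := tP i; exists v.
  have [v vE] := choice lift.
  have [|c pc [w _ wE]] := cob ([ffun i => s *: v i] : {ffun 'I_n -> X}).
    move=> i j; rewrite !ffunE !scalerA ![_ * s]mulrC -!scalerA.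
    apply/eqP; rewrite -subr_eq0 -scalerBr; apply/eqP/sT/ra.
    exists 1; first exact: prime_n1.
    rewrite /= scale1r scalerBr !scalerA ![a * _]mulrC -!scalerA !vE.
    rewrite !scalerA; apply/eqP; rewrite subr_eq0; apply/eqP.
    by congr (_ *: _); ring.
  have gw i : g i *: w = c *: (s *: v i).
    by have := congr1 (fun f : {ffun 'I_n -> X} => f i) wE; rewrite !ffunE.
  exists (c * s * t); first by apply: prime_nM => //; exact: prime_nM.
  exists w => //; apply/eqP; rewrite -subr_eq0; apply/eqP/p0 => r pr.
  apply: (gP X [set 0] _ (is_submod0 X) _ r pr) => i /=.
  have gaw : g i *: (a *: w) = (c * s) *: (a *: v i).
    rewrite scalerA [g i * a]mulrC -[LHS]scalerA gw !scalerA.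
    by congr (_ *: _); ring.
  apply/eqP; rewrite scalerBr subr_eq0 gaw vE !scalerA.
  by apply/eqP; congr (_ *: _); ring.
have [b pb rb] := regular_elt hR noethX (is_submod_sat p haX) aX0.
apply: nreg; exists a, b; split=> //; apply: contrapT => all.
apply: Tx0; apply: (nakayama noethX pa pb) => x.
by apply: contrapT => nx; apply: all; exists x.
Qed.

Lemma cyc_ker_of_torsionfree X p : C X ->
  (forall x : X, (forall r, prime_set p r -> r *: x = 0) -> x = 0) ->
  (exists x, ~ tors p X x) ->
  ~ (exists a b, loc_regular2 p X a b) -> cyc_ker p.
Proof.
move=> CX p0 supX nreg.
have [n [g [pg gP]]] := ideal_gens (is_submod_prime p).
have [w cw nw] := noncoboundary_ex pg gP p0 supX nreg.
have hB := is_submod_koszul_im X g.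
apply: (@cyc_ker_of_class p _ (range (koszul_d g)) (cocycles g) w) => //.
- apply: inC_koszul_im => // x /koszul_d_eq0 gx; apply: p0 => r pr.
  exact: (gP X [set 0] x (is_submod0 X) gx r pr).
- exact: inC_cocycles.
- by move=> _ [x _ <-]; exact: koszul_d_cocycle.
move=> t; split=> [pt|Bt]; last first.
  by apply: contrapT => pt; apply: nw; exists t.
apply: gP hB _ t pt => i.
  by rewrite cocycle_scale //; exact: imageT.
Qed.

(** If the localization of [X] at [p] has depth zero, [X] contains [R/p].
    Otherwise let [K] be maximal among the submodules whose annihilator [J] lies
    only in primes strictly above [p]. The cocycles of [J] in [X] belong to [C],
    and the coboundaries, which form a copy of [X/K], are reached from them
    through primes strictly above [p]. The module [X/K] is [X] at [p] and has no
    nonzero element killed by [p]. *)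
Lemma cyc_ker_step X p : C X -> (exists x, ~ tors p X x) ->
  (forall Y, (exists y, ~ tors p Y y) -> ~ exists a b, loc_regular2 p Y a b) ->
  (forall q, p `<` q -> cyc_ker q) -> cyc_ker p.
Proof.
move=> CX [x0 Tx0] depth1 IH; have noethX := fgmod_noeth hR X.
have [s ps sT] := tors_killed p noethX.
have [[x Tx px]|nodepth0] := pselect (exists2 x, ~ tors p X x &
    forall r, prime_set p r -> tors p X (r *: x)).
  (* [s *: x] generates a copy of [R/p] in [X]. *)
  apply: (@cyc_ker_of_class p X [set 0] setT (s *: x)) => //.
  - exact: inC0.
  - exact: inCT.
  move=> t; split=> [pt|t0].
    by rewrite /= scalerA mulrC -scalerA; apply: sT; exact: px.
  apply: contrapT => pt; apply: Tx; exists (t * s); first exact: prime_nM.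
  by rewrite -scalerA.
have pT x : (forall r, prime_set p r -> tors p X (r *: x)) -> tors p X x.
  by move=> px; apply: contrapT => Tx; apply: nodepth0; exists x.
pose ann (K : set X) : set R^o := [set r | forall k, K k -> r *: k = 0].
pose above (K : set X) := forall q, ann K `<=` q -> p `<` q.
have [|K [hK Kabove Kmax]] := noeth_max noethX (P := above).
  exists [set 0]; first exact: is_submod0.
  move=> q annq; case: (@prime_n1 _ q).
  by apply: annq => k ->; rewrite scaler0.
pose J := ann K; have hJ : is_submod J.
  split=> [k _|r r' Jr Jr' k Kk|r r' Jr k Kk].
  - by rewrite scale0r.
  - by rewrite scalerDl Jr // Jr' // addr0.
  - by rewrite -scalerA Jr // scaler0.
have [t Jt pt] : exists2 t, J t & ~ prime_set p t.
  apply: contrapT => no; have [_] : p `<` p; last by apply.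
  apply: Kabove => t Jt; apply: contrapT => pt; apply: no; by exists t.
(* The support of [K] avoids [p], so [K] dies at [p]. *)
have KT k : K k -> tors p X k by move=> Kk; exists t => //; exact: Jt.
have JK x : (forall r, J r -> r *: x = 0) -> K x.
  pose K2 : set X := [set x | forall r, J r -> r *: x = 0].
  move=> Jx; apply: (Kmax K2) => // [|k Kk r|q K2q].
  - split=> [r _|u v Ju Jv r Jr|c u Ju r Jr]; first by rewrite scaler0.
      by rewrite scalerDr Ju // Jv // addr0.
    by rewrite scalerA mulrC -scalerA Ju // scaler0.
  - by apply.
  - by apply: Kabove => r Jr; apply: K2q => k; apply.
(* Adding to [K] an element [x] with [p x] inside [K] keeps its annihilator in
   primes strictly above [p] only: a prime containing it but not [J] contains
   [p] and the element [s] outside [p]. *)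
have pK x : (forall r, prime_set p r -> K (r *: x)) -> K x.
  move=> px.
  have Tx : tors p X x.
    apply: (sat_cancel pt); apply: pT => r pr; apply: KT.
    by rewrite scalerA mulrC -scalerA; have [_ _ KZ] := hK; apply/KZ/px.
  have sx := sT _ Tx.
  apply: (Kmax (add_line K x)).
  - exact: is_submod_add_line.
  - exact: sub_add_line.
  - move=> q Lq; have [Jq|nJq] := pselect (J `<=` q); first exact: Kabove.
    have [j Jj qj] : exists2 j, J j & ~ prime_set q j.
      apply: contrapT => no; apply: nJq => j Jj; apply: contrapT => qj.
      by apply: no; exists j.
    have qmul r : j *: (r *: x) = 0 -> prime_set q r.
      move=> jrx; apply: contrapT => qr; apply: (prime_nM qj qr).
      apply: Lq => y [c Kyc]; rewrite -[y](subrK (c *: x)) scalerDr.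
      have -> : (j * r) *: (y - c *: x) = 0.
        by rewrite mulrC -scalerA Jj // scaler0.
      by rewrite add0r scalerA mulrC -scalerA -scalerA jrx scaler0.
    split=> [r pr|qp]; first by apply: qmul; apply: Jj; exact: px.
    by apply: ps; apply: qp; apply: qmul; rewrite sx scaler0.
  - exact: mem_add_line.
have [n [g [Jg gP]]] := ideal_gens hJ.
have dK x : koszul_d g x = 0 <-> K x.
  rewrite koszul_d_eq0; split=> [gx|Kx i]; last exact: Jg.
  by apply: JK; exact: (gP X [set 0] x (is_submod0 X) gx).
have [hY CY] : inC (range (koszul_d (X := X) g)).
  apply: (inC_descend (inC_cocycles g CX) (is_submod_koszul_im X g)).
    by move=> _ [x _ <-]; exact: koszul_d_cocycle.
  move=> q qP; apply/IH/Kabove => r Jr; apply: qP => w cw.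
  apply: gP (is_submod_koszul_im X g) _ r Jr => i.
  by rewrite cocycle_scale //; exact: imageT.
have lemb := @emb_lin _ _ _ hY.
have supY : exists y, ~ tors p (subfg hR hY) y.
  have [y yE] : exists y : subm hY, emb y = koszul_d g x0.
    by apply: emb_onto; exists x0.
  exists y => -[c pc cy]; apply: Tx0; apply: (sat_cancel pc); apply: KT.
  by apply/dK; rewrite (linZ (koszul_d_lin g)) -yE -(linZ lemb) cy (lin0 lemb).
apply: (cyc_ker_of_torsionfree CY _ supY (depth1 _ supY)) => y py.
apply: emb_inj; rewrite (lin0 lemb); have [x _ xE] := emb_in y; rewrite -xE.
apply/dK; apply: pK => r pr; apply/dK.
by rewrite (linZ (koszul_d_lin g)) xE -(linZ lemb) py // (lin0 lemb).
Qed.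

Lemma cyc_ker_all :
  (forall X p, (exists x, ~ tors p X x) ->
     ~ exists a b, loc_regular2 p X a b) ->
  forall p, cyc_ker p.
Proof.
move=> depth1.
suff all (I : set R^o) : is_submod I ->
    forall p, I = prime_set p -> cyc_ker p.
  by move=> p; apply: all (is_submod_prime p) _ erefl.
move: I; apply: (noeth_ind (noetherian_ideal hR)) => I hI IH p Ip.
move=> X M N x hM MN Nx NM px CN; have [hN CX] := CN.
have cyc_p : cyc_ker p.
  apply: (@cyc_ker_step (subfg hR hN) p) => // [|Y|q pq].
  - have [y yE] := emb_onto hN Nx; exists y => -[s ps sy].
    apply: ps; apply/px; rewrite -yE -(linZ (@emb_lin _ _ _ hN)).
    by rewrite sy (lin0 (@emb_lin _ _ _ hN)); case: hM.
  - exact: depth1.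
  - by apply: (IH (prime_set q) (is_submod_prime q) _ q erefl); rewrite Ip.
exact: cyc_p hM MN Nx NM px CN.
Qed.

Lemma ke_sub_closed : (forall p, cyc_ker p) -> sub_closed C.
Proof.
move=> cyc X Y f fI CY; apply: (inC_range (hR := hR) hC fI).
have lf : linear f by move=> a u v; rewrite linearP.
apply: (inC_descend (inCT hR hC CY)) => //.
exact: (is_submod_image lf (is_submodT X)).
Qed.

End CyclicQuotients.

Theorem proposition5p15 (R : comPzRingType) (hR : noetherian R) :
  ke R = torf R <->
  forall (X : fgmod R) (p : prime_ideal R), supp X p ->
    (@depth (loc_ring p) (loc_mod p X) <= 1)%E.
Proof.
split=> [eqC X p supX|depth1].
  by apply/(depth_le1P supX) => -[a [b]]; exact: ke_torf_no_regular.
have nreg (X : fgmod R) (p : prime_ideal R) : (exists x, ~ tors p X x) ->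
    ~ exists a b, loc_regular2 p X a b.
  by move=> /supp_tors supX; apply/(depth_le1P supX); exact: depth1.
apply/funext => C; apply/propext; split=> [hC|[addC extC subC]].
  have [addC extC _] := hC; split=> //.
  have cyc (p : prime_ideal R) : cyc_ker hR C p by exact: cyc_ker_all.
  exact: (ke_sub_closed hC cyc).
split=> // X Y K f k kI _ CX _; exact: subC kI CX.
Qed.
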